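(* Consider the social learning setting described in the context, and suppose: (i) (finite KL divergences) $D[f_k\|L_k(\theta)]<\infty$ for all $k=1,\ldots,N$ and all $\theta\in\Theta$; (ii) (initial beliefs) $\mu_{k,0}(\theta)>0$ for all $\theta\in\Theta$ and all $k$; (iii) (unique minimizer) for each receiving agent $k\in\mathcal{R}$ the function $\mathscr{D}_k(\theta)=\sum_{\ell\in\mathcal{S}}\omega_{\ell k}\,D[f_\ell\|L_\ell(\theta)]$ has a unique minimizer $\theta^\star_k=\arg\min_{\theta\in\Theta}\mathscr{D}_k(\theta)$. Then for every receiving agent $k\in\mathcal{R}$, $$\lim_{i\to\infty}\boldsymbol{\mu}_{k,i}(\theta^\star_k)=1\quad\text{almost surely},$$ and for every $\theta\neq\theta^\star_k$, $$\lim_{i\to\infty}\frac{\log\boldsymbol{\mu}_{k,i}(\theta)}{i}=\mathscr{D}_k(\theta^\star_k)-\mathscr{D}_k(\theta)\quad\text{almost surely}$$ (in particular these limits exist almost surely).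
   Context: Data and inference model: there are $N$ agents; agent $k$ observes at each time $i\in\mathbb{N}$ a random variable $\boldsymbol{\xi}_{k,i}\in\mathcal{X}_k$. For each $k$, the variables $\{\boldsymbol{\xi}_{k,i}\}_{i}$ are independent over time and identically distributed with true distribution $f_k$ (data may be dependent across agents). All data are either continuous (densities) or discrete (probability mass functions), with the same nature for all agents. There is a finite set of hypotheses $\Theta=\{1,\ldots,H\}$, and agent $k$ has likelihood functions $L_k(\xi|\theta)$, $\xi\in\mathcal{X}_k$, $\theta\in\Theta$. The KL divergence is $D[f_k\|L_k(\theta)]=\mathbb{E}_{f_k}\big[\log\frac{f_k(\boldsymbol{\xi}_k)}{L_k(\boldsymbol{\xi}_k|\theta)}\big]$. Algorithm: starting from initial beliefs $\mu_{k,0}$ (probability mass functions on $\Theta$), at each time $i\ge1$ each agent $k$ computes $$\boldsymbol{\psi}_{k,i}(\theta)=\frac{\boldsymbol{\mu}_{k,i-1}(\theta)L_k(\boldsymbol{\xi}_{k,i}|\theta)}{\sum_{\theta'\in\Theta}\boldsymbol{\mu}_{k,i-1}(\theta')L_k(\boldsymbol{\xi}_{k,i}|\theta')},\qquad \boldsymbol{\mu}_{k,i}(\theta)=\frac{\exp\{\sum_{\ell=1}^N a_{\ell k}\log\boldsymbol{\psi}_{\ell,i}(\theta)\}}{\sum_{\theta'\in\Theta}\exp\{\sum_{\ell=1}^N a_{\ell k}\log\boldsymbol{\psi}_{\ell,i}(\theta')\}},$$ where $A=[a_{\ell k}]$ is an $N\times N$ matrix with nonnegative entries that is left-stochastic ($\sum_{\ell}a_{\ell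 k}=1$ for all $k$), with $a_{\ell k}=0$ unless agent $k$ receives information from agent $\ell$. Weak graph: the agents are partitioned into $S+R$ disjoint sub-networks $\mathcal{N}_1,\ldots,\mathcal{N}_{S+R}$ (agents listed in increasing order across components), with sending part $\mathcal{S}=\bigcup_{s=1}^S\mathcal{N}_s$ and receiving part $\mathcal{R}=\bigcup_{r=1}^R\mathcal{N}_{S+r}$. The matrix $A$ has the block form $A=\begin{bmatrix}A_{\mathcal{S}}&A_{\mathcal{S}\mathcal{R}}\\0&A_{\mathcal{R}}\end{bmatrix}$ with $A_{\mathcal{S}}=\mathrm{blockdiag}\{A_{\mathcal{N}_1},\ldots,A_{\mathcal{N}_S}\}$ (no links between distinct sending sub-networks and no links from receiving to sending agents). Each sending sub-network is strongly connected (its graph is connected and at least one of its agents has $a_{\ell\ell}>0$), with Perron vector $p^{(s)}$: $A_{\mathcal{N}_s}p^{(s)}=p^{(s)}$, $\mathbb{1}^\top p^{(s)}=1$, all entries positive. Each receiving sub-network is connected, and each receiving sub-network is connected to at least one agent in each sending sub-network. In this setting $I-A_{\mathcal{R}}$ is invertible and $\lim_{i\to\infty}A^i=\begin{bmatrix}E&\Omega\\0&0\end{bmatrix}$, where $E=\mathrm{blockdiag}\{p^{(1)}\mathbb{1}_{N_1}^\top,\ldots,p^{(S)}\mathbb{1}_{N_S}^\top\}$ ($N_s=|\mathcal{N}_s|$) and $\Omega=EA_{\mathcal{S}\mathcal{R}}(I-A_{\mathcal{R}})^{-1}$. The entries of $\Omega$ are denoted $\omega_{\ell k}$, $\ell\in\mathcal{S}$,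 $k\in\mathcal{R}$ (columns indexed by the receiving agents' labels). *)

(* Defs.v *)
From HB Require Import structures.
From mathcomp Require Import all_boot all_order all_algebra.
From mathcomp Require Import all_classical all_reals all_analysis.
Set Implicit Arguments. Unset Strict Implicit. Unset Printing Implicit Defensive.
Import Order.TTheory GRing.Theory Num.Theory.
Import numFieldNormedType.Exports.
Local Open Scope classical_set_scope.
Local Open Scope ring_scope.

Definition mutually_independent {dO dT : measure_display} {R : realType}
  {Omega : measurableType dO} {T : measurableType dT}
  (P : probability Omega R) (Y : nat -> Omega -> T) : Prop :=
  forall (s : seq nat) (B : nat -> set T), uniq s ->
    (forall i, measurable (B i)) ->
    P (\bigcap_(i in [set` s]) (Y i @^-1` B i)) =
    (\prod_(i <- s) P (Y i @^-1` B i))%E.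

Definition kl_integrand {R : realType} (a b : R) : \bar R :=
  if a == 0 then 0%E else if b == 0 then +oo%E else (a * ln (a / b))%:E.

(* D[f || L] = E_f[ log (f / L) ] = \int f log (f / L) d nu, where f and L are
   densities (pdf or pmf) w.r.t. the reference measure nu. *)
Definition KL {dX : measure_display} {R : realType} {X : measurableType dX}
  (nu : {measure set X -> \bar R}) (f L : X -> R) : \bar R :=
  (\int[nu]_x kl_integrand (f x) (L x))%E.

Definition bayes_update {R : realType} {H : nat} (m lik : 'I_H -> R) : 'I_H -> R :=
  fun th => m th * lik th / \sum_(th' < H) m th' * lik th'.

(* Geometric-average combination:
   mu_k(theta) = exp{sum_l a_lk log psi_l(theta)} / normalization,
   written as prod_l psi_l(theta)^{a_lk} (powR, with 0^0 = 1, 0^a = 0 for a > 0). *)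
Definition combine {R : realType} {N H : nat} (A : 'M[R]_N)
  (psi : 'I_N -> 'I_H -> R) (k : 'I_N) : 'I_H -> R :=
  fun th => (\prod_(l < N) powR (psi l th) (A l k)) /
            \sum_(th' < H) \prod_(l < N) powR (psi l th') (A l k).

(* beliefs mu0 A lik i k theta = mu_{k,i}(theta), where lik j l theta is the
   likelihood L_l(xi_{l,j+1} | theta) of the observation used at step j+1. *)
Fixpoint beliefs {R : realType} {N H : nat} (mu0 : 'I_N -> 'I_H -> R)
  (A : 'M[R]_N) (lik : nat -> 'I_N -> 'I_H -> R) (i : nat) : 'I_N -> 'I_H -> R :=
  match i with
  | 0 => mu0
  | j.+1 =>
      let prev := beliefs mu0 A lik j in
      let psi := fun l => bayes_update (prev l) (lik j l) in
      fun k => combine A psi k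
  end.

(* directed path from l to k inside the sub-network {x | c x == s}, using links
   with positive weight M x y > 0 (x sends to y) *)
Definition path_within {R : realType} {n m : nat} (M : 'M[R]_n) (c : 'I_n -> 'I_m)
  (s : 'I_m) (l k : 'I_n) : bool :=
  connect (fun x y => [&& c x == s, c y == s & 0 < M x y]) l k.

(* E = blockdiag{p^(1) 1^T, ..., p^(S) 1^T} *)
Definition Emx {R : realType} {NS S : nat} (cS : 'I_NS -> 'I_S) (p : 'I_NS -> R)
  : 'M[R]_NS := \matrix_(l, l') (if cS l == cS l' then p l else 0).

Definition Omx {R : realType} {NS NR S : nat} (A : 'M[R]_(NS + NR))
  (cS : 'I_NS -> 'I_S) (p : 'I_NS -> R) : 'M[R]_(NS, NR) :=
  Emx cS p *m ursubmx A *m invmx (1%:M - drsubmx A).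

(* D_k(theta) = sum_{l in S} omega_{lk} D[f_l || L_l(theta)]  (k receiving agent);
   the KL divergences are assumed finite, so we take their real values. *)
Definition Dagg {R : realType} {NS NR S H : nat} (A : 'M[R]_(NS + NR))
  (cS : 'I_NS -> 'I_S) (p : 'I_NS -> R)
  (dX : 'I_(NS + NR) -> measure_display) (X : forall k, measurableType (dX k))
  (nu : forall k, {measure set (X k) -> \bar R})
  (f : forall k, X k -> R) (L : forall k, X k -> 'I_H -> R)
  (k : 'I_NR) (th : 'I_H) : R :=
  \sum_(l < NS) Omx A cS p l k *
     fine (KL (nu (lshift NR l)) (f (lshift NR l)) (fun x => L (lshift NR l) x th)).

(* Main.v *)
(* The log-belief ratios against a fixed hypothesis obey a linear recursion
   lam_{i+1} = (lam_i + x_i) A, where x_i collects the log-likelihood ratios of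
   the i-th observations.  Finite KL divergences make log (f / L) integrable, so
   the strong law of large numbers gives almost surely
   x_0 + ... + x_{i-1} = i c + o(i) with c_l = D[f_l || L_l(ts)] - D[f_l || L_l(th)];
   the rest is deterministic.  In a sending sub-network some power of A dominates
   a multiple of the Perron projection E, so lam_i - lam_i E is contracted and
   lam_i = i c E + o(i) there.  Some power of the receiving block is a strict
   contraction in sup norm, whence lam_i = i c Omega + o(i) for receiving agents.
   A negative growth rate for every th != ts is concentration of the belief.

   The strong law for nonnegative variables follows Etemadi: truncate the first n
   variables at level n, apply Chebyshev and Borel-Cantelli along n = j 2^k for
   each fixed j, and interpolate by monotonicity. *)
Require Import Defs.
From HB Require Import structures.
From mathcomp Require Import all_boot all_order all_algebra.
From mathcomp Require Import all_classical all_reals all_analysis.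
From mathcomp Require Import measurable_realfun.
From mathcomp Require Import ring lra zify.
Import Order.TTheory GRing.Theory Num.Theory.
Import numFieldNormedType.Exports.
Local Open Scope classical_set_scope.
Local Open Scope ring_scope.

(** * The strong law of large numbers *)

Lemma ge0_integral_same_law {R : realType} {dO dT : measure_display}
  {Omega : measurableType dO} {T : measurableType dT}
  (P : probability Omega R) (X Y : Omega -> T) (h : T -> \bar R) :
  measurable_fun [set: Omega] X -> measurable_fun [set: Omega] Y ->
  (forall B, measurable B -> P (X @^-1` B) = P (Y @^-1` B)) ->
  measurable_fun [set: T] h -> (forall x, 0 <= h x)%E ->
  (\int[P]_w h (X w) = \int[P]_w h (Y w))%E.
Proof.
move=> mX mY XY mh h0.
pose X' := mfun_Sub (mem_set mX); pose Y' := mfun_Sub (mem_set mY).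
rewrite -[LHS](@ge0_integral_distribution _ _ _ _ _ P X')//.
rewrite -[RHS](@ge0_integral_distribution _ _ _ _ _ P Y')//.
by apply: eq_measure_integral => B mB _; exact: XY.
Qed.

(** Independence makes the law of the pair agree with the product law on rectangles, hence
    everywhere; Tonelli then factorises the integral, with no integrability required of [h] and
    [k]. *)
Lemma ge0_integral_indepM {R : realType} {dO dT : measure_display}
  {Omega : measurableType dO} {T : measurableType dT}
  (P : probability Omega R) (X Y : Omega -> T) (h k : T -> \bar R) :
  measurable_fun [set: Omega] X -> measurable_fun [set: Omega] Y ->
  (forall A B, measurable A -> measurable B ->
    P (X @^-1` A `&` Y @^-1` B) = P (X @^-1` A) * P (Y @^-1` B))%E ->
  measurable_fun [set: T] h -> (forall x, 0 <= h x)%E ->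
  measurable_fun [set: T] k -> (forall x, 0 <= k x)%E ->
  (\int[P]_w (h (X w) * k (Y w)) = \int[P]_w h (X w) * \int[P]_w k (Y w))%E.
Proof.
move=> mX mY XY mh h0 mk k0.
pose X' := mfun_Sub (mem_set mX); pose Y' := mfun_Sub (mem_set mY).
have mZ : measurable_fun setT (fun w => (X w, Y w)) by exact: measurable_fun_pair.
pose Z' : {mfun Omega >-> (T * T)%type} := mfun_Sub (mem_set mZ).
pose hk (z : T * T) := (h z.1 * k z.2)%E.
have mhk : @measurable_fun _ _ (T * T)%type (\bar R) setT hk.
  by apply: emeasurable_funM; exact: measurableT_comp.
have hk0 z : (0 <= hk z)%E by rewrite mule_ge0.
transitivity (\int[distribution P Z']_z hk z)%E.
  by rewrite (@ge0_integral_distribution _ _ _ _ _ P Z' hk mhk hk0).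
rewrite -(@ge0_integral_distribution _ _ _ _ _ P X' h)//.
rewrite -(@ge0_integral_distribution _ _ _ _ _ P Y' k)//.
have E1 : forall A, measurable A ->
    (distribution P X' \x distribution P Y')%E A = distribution P Z' A.
  apply: product_measure_unique => A B mA mB.
  by rewrite /= /distribution /pushforward /= -XY.
transitivity (\int[distribution P X' \x distribution P Y']_z hk z)%E.
  by apply: eq_measure_integral => A mA _; exact: (esym (E1 A mA)).
rewrite fubini_tonelli1//= /fubini_F/hk/=.
under eq_integral => x _ do rewrite ge0_integralZl//.
rewrite ge0_integralZr//; exact: integral_ge0.
Qed.

Lemma bounded_Lfun2 {R : realType} {dO : measure_display}
  {Omega : measurableType dO} (P : probability Omega R) (X : Omega -> R) (M : R) :
  measurable_fun [set: Omega] X -> (forall w, `|X w| <= M) -> X \in Lfun P 2%:E.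
Proof.
move=> mX XM; rewrite inE/=; apply/andP; split; rewrite inE//=.
rewrite /finite_norm unlock poweR_lty//.
apply: (@le_lt_trans _ _ (\int[P]_x (cst (M `^ 2)%:E x))%E).
  apply: ge0_le_integral => //=.
  - apply/measurable_EFinP; apply: (measurableT_comp (measurable_powR _)).
    exact: measurableT_comp.
  - move=> x _; rewrite lee_fin; apply: ge0_ler_powR => //; rewrite nnegrE//.
    exact: le_trans (XM x).
by rewrite integral_cst//= probability_setT mule1 ltry.
Qed.

(** * Chebyshev bound for sums of bounded, pairwise uncorrelated variables *)

Section weak_law.
Context {R : realType} {dO : measure_display} {Omega : measurableType dO}.
Variables (P : probability Omega R) (Y : nat -> Omega -> R) (M m s : R).
Hypotheses (mY : forall i, measurable_fun [set: Omega] (Y i))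
  (Y_bnd : forall i w, `|Y i w| <= M)
  (EY : forall i, ('E_P[Y i] = m%:E)%E)
  (EY2 : forall i, ('E_P[Y i * Y i] <= s%:E)%E)
  (EYY : forall i j, i != j -> ('E_P[Y i * Y j] = (m * m)%:E)%E).

Let S n := \sum_(i < n) Y i.

Let L2Y i : Y i \in Lfun P 2%:E.
Proof. exact: bounded_Lfun2 (Y_bnd i). Qed.

Let L2S n : S n \in Lfun P 2%:E.
Proof. by rewrite rpred_sum ?lee1n. Qed.

Let Pfin : P setT \is a fin_num := fin_num_measure P _ measurableT.

Let cov0 n k : (n <= k)%N -> covariance P (S n) (Y k) = 0%E.
Proof.
elim: n => [|n IH] nk; rewrite /S.
  by rewrite big_ord0 (covariance_cst_l P 0).
rewrite big_ord_recr/= covarianceDl// ?L2S// IH ?(ltnW nk)// add0e.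
rewrite covarianceE ?Lfun2_mul_Lfun1// ?Lfun_subset12//.
by rewrite EYY ?neq_ltn ?nk// !EY -EFinM subee.
Qed.

(** [Y n] is uncorrelated with the earlier partial sum, so variances add up, each being at most the
    second moment. *)
Let var_sum n : ('V_P[S n] <= (n%:R * s)%:E)%E.
Proof.
elim: n => [|n IH]; first by rewrite /S big_ord0 (variance_cst P 0) mul0r.
rewrite /S big_ord_recr/= varianceD// ?L2S// cov0// mule0 adde0.
rewrite -natr1 mulrDl mul1r EFinD leeD// varianceE//.
rewrite (le_trans _ (EY2 n))// EY -EFin_expe leeBlDr//.
by rewrite leeDl// lee_fin sqr_ge0.
Qed.

Lemma chebyshev_sum n (e : R) : 0 < e ->
  (P [set w | e <= `|\sum_(i < n) Y i w - n%:R * m|]%R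
    <= (n%:R * s / e ^+ 2)%:E)%E.
Proof.
move=> e0.
have mS : measurable_fun [set: Omega] (S n).
  by have := L2S n; rewrite inE => /andP[]; rewrite inE.
have ES : ('E_P[S n] = (n%:R * m)%:E)%E.
  rewrite /S; elim: n {mS} => [|n IH].
    by rewrite big_ord0 (expectation_cst P 0) mul0r.
  rewrite big_ord_recr/= expectationD; last 2 first.
  - exact/Lfun_subset12/L2S.
  - exact: Lfun_subset12.
  by rewrite IH EY -natr1 mulrDl mul1r.
have := @chebyshev _ _ _ P (mfun_Sub (mem_set mS)) _ e0.
rewrite /= ES/=.
under eq_set => w do rewrite /S fct_sumE.
move=> /le_trans; apply.
rewrite mulrC EFinM lee_pmul2l//.
  by rewrite lte_fin invr_gt0 exprn_gt0.
Qed.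
End weak_law.

(** The nonzero terms form a geometric progression of ratio 2 whose last term is below [x], so their
    sum is at most twice that term. *)
Lemma sum_dyadic_below {R : realType} (x a : R) K : 0 <= x -> 0 < a ->
  \sum_(n < K) a * 2 ^+ n * (a * 2 ^+ n < x)%R%:R <= 2 * x.
Proof.
move=> x0 a0; elim: K => [|K IH]; first by rewrite big_ord0 mulr_ge0.
have [xK|xK] := ltP (a * 2 ^+ K) x; last first.
  by rewrite big_ord_recr/= ltNge xK/= mulr0 addr0.
have sumE : \sum_(n < K.+1) a * 2 ^+ n = a * 2 ^+ K.+1 - a.
  elim: {IH xK} K => [|K IHK]; first by rewrite big_ord1 expr0 expr1; ring.
  by rewrite big_ord_recr/= IHK !exprS; ring.
apply: (@le_trans _ _ (\sum_(n < K.+1) a * 2 ^+ n)).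
  apply: ler_sum => n _; rewrite ler_piMr//; first by rewrite mulr_ge0 ?exprn_ge0 ?ltW.
  by rewrite lern1 leq_b1.
rewrite sumE exprS; nra.
Qed.

(** The surviving denominators start at some value at least [x] and double, so their reciprocals sum
    to at most [2 / x]. The induction varies [a]: when [a < x] the first term vanishes and [a] is
    doubled. *)
Lemma sum_dyadic_above {R : realType} (x a : R) K : 0 <= x -> 0 < a ->
  \sum_(n < K) x ^+ 2 * (x <= a * 2 ^+ n)%R%:R / (a * 2 ^+ n) <= 2 * x.
Proof.
move=> x0; elim: K a => [|K IH] a a0; first by rewrite big_ord0 mulr_ge0.
have [xa|xa] := leP x a; last first.
  rewrite big_ord_recl/= expr0 mulr1 (leNgt x a) xa mulr0 mul0r add0r.
  rewrite (le_trans _ (IH (a * 2) _)) ?mulr_gt0//.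
  by apply: ler_sum => n _; rewrite /bump/= add1n (exprS 2 n) (mulrA a).
apply: (@le_trans _ _ (x ^+ 2 / a * \sum_(n < K.+1) (2 ^+ n)^-1)).
  rewrite mulr_sumr; apply: ler_sum => n _; rewrite invfM mulrA ler_wpM2r//.
  rewrite ler_wpM2r//; first by rewrite invr_ge0 ltW.
  rewrite ler_piMr ?sqr_ge0//.
  by rewrite lern1 leq_b1.
have -> : \sum_(n < K.+1) ((2 : R) ^+ n)^-1 = 2 - (2 ^+ K)^-1.
  elim: {IH} K => [|K IHK]; first by rewrite big_ord1 expr0 invr1; ring.
  rewrite big_ord_recr/= IHK exprS invfM.
  have : (2 : R) ^+ K != 0 by rewrite expf_neq0.
  by move=> ?; field.
apply: (@le_trans _ _ (x ^+ 2 / a * 2)).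
  rewrite ler_wpM2l ?divr_ge0 ?sqr_ge0 ?(ltW a0)//.
  by rewrite gerBl// invr_ge0 exprn_ge0.
rewrite mulrC ler_wpM2l// ler_pdivrMr// expr2 ler_wpM2l//.
Qed.

(** The first Borel-Cantelli lemma, with bounded partial sums expressing summability. *)
Lemma ae_eventually_not {R : realType} {dO : measure_display}
  {Omega : measurableType dO} (P : probability Omega R)
  (F : nat -> set Omega) (C : R) : (forall n, measurable (F n)) ->
  (forall K, \sum_(n < K) P (F n) <= C%:E)%E ->
  {ae P, forall w, \forall n \near \oo, ~ F n w}.
Proof.
move=> mF FC.
exists (lim_sup_set F); split.
- by apply: bigcap_measurable => // k _; exact: bigcup_measurable.
- apply: lim_sup_set_cvg0 => //.
  apply: (@le_lt_trans _ _ C%:E); last by rewrite ltry.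
  apply: lime_le; first exact: is_cvg_nneseries.
  by apply: nearW => K; rewrite big_mkord.
- move=> w /= nw n _; apply: contrapT => H; apply: nw.
  exists n => // k /= nk Fkw; apply: H; exists k => //.
Qed.

(** Cutting at 0 as well as at [a] keeps the values in [[0, a]] on the whole line when [a] is
    nonnegative. *)
Definition trunc {R : realType} (a x : R) : R := x * \1_(`[0, a]) x.

Section trunc.
Context {R : realType}.
Implicit Types a x : R.

Lemma truncE a x : 0 <= x -> trunc a x = x * (x <= a)%R%:R.
Proof. by move=> x0; rewrite /trunc indicE mem_setE in_itv/= x0. Qed.

Lemma trunc_ge0 a x : 0 <= trunc a x.
Proof.
rewrite /trunc indicE mem_setE in_itv/=.
by have [x0|x0] := leP 0 x; rewrite /= ?mulr0// mulr_ge0.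
Qed.

Lemma trunc_le a x : 0 <= a -> trunc a x <= a.
Proof.
move=> a0; rewrite /trunc indicE mem_setE in_itv/=.
have [x0|x0] := leP 0 x; rewrite /= ?mulr0//.
by have [xa|xa] := leP x a; rewrite ?mulr1// mulr0.
Qed.

Lemma measurable_trunc a : measurable_fun [set: R] (trunc a).
Proof. by apply: measurable_funM => //; exact: measurable_indic. Qed.
End trunc.

(** * Truncation and almost sure convergence along [j * 2 ^ k] *)

Section dyadic.
Context {R : realType} {dO : measure_display} {Omega : measurableType dO}.
Variables (P : probability Omega R) (X : nat -> Omega -> R) (mu : R).
Hypotheses (mX : forall i, measurable_fun [set: Omega] (X i))
  (X_ge0 : forall i w, 0 <= X i w)
  (X_law : forall i B, measurable B -> P (X i @^-1` B) = P (X 0%N @^-1` B))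
  (X_ind : forall i j, i != j -> forall A B, measurable A -> measurable B ->
    P (X i @^-1` A `&` X j @^-1` B) = (P (X i @^-1` A) * P (X j @^-1` B))%E)
  (EX : (\int[P]_w (X 0%N w)%:E = mu%:E)%E).

Let Y (a : R) i w := trunc a (X i w).
Let m a := fine (\int[P]_w (Y a 0 w)%:E)%E.
Let s a := fine (\int[P]_w (Y a 0 w ^+ 2)%:E)%E.

Let mY a i : measurable_fun [set: Omega] (Y a i).
Proof. exact: (measurableT_comp (measurable_trunc a)). Qed.

Let fin_bounded (f : Omega -> R) (M : R) : measurable_fun [set: Omega] f ->
  (forall w, 0 <= f w <= M) -> (\int[P]_w (f w)%:E)%E \is a fin_num.
Proof.
move=> mf f0M; rewrite ge0_fin_numE; last first.
  by apply: integral_ge0 => w _; rewrite lee_fin; case/andP: (f0M w).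
apply: (@le_lt_trans _ _ (\int[P]_w (cst M%:E w))%E).
  apply: ge0_le_integral => //=.
  - by move=> w _; rewrite lee_fin; case/andP: (f0M w).
  - exact/measurable_EFinP.
  - by move=> w _; rewrite lee_fin; case/andP: (f0M w).
by rewrite integral_cst//= probability_setT mule1 ltry.
Qed.

Let EY (a : R) i : 0 <= a -> (\int[P]_w (Y a i w)%:E = (m a)%:E)%E.
Proof.
move=> a0; rewrite /m fineK; last first.
  by apply: (@fin_bounded _ a) => // w; rewrite trunc_ge0 trunc_le.
apply: (@ge0_integral_same_law _ _ _ _ _ P (X i) (X 0%N) (fun x => (trunc a x)%:E)) => //.
- by move=> B; exact: X_law.
- by apply/measurable_EFinP; exact: measurable_trunc.
- by move=> x; rewrite lee_fin trunc_ge0.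
Qed.

Let EY2 (a : R) i : 0 <= a -> (\int[P]_w (Y a i w ^+ 2)%:E = (s a)%:E)%E.
Proof.
move=> a0; rewrite /s fineK; last first.
  apply: (@fin_bounded _ (a ^+ 2)) => [|w]; first exact: measurable_funX.
  by rewrite sqr_ge0/= lerXn2r ?nnegrE ?trunc_ge0 ?trunc_le.
apply: (@ge0_integral_same_law _ _ _ _ _ P (X i) (X 0%N)
  (fun x => (trunc a x ^+ 2)%:E)) => //.
- by move=> B; exact: X_law.
- by apply/measurable_EFinP/measurable_funX; exact: measurable_trunc.
- by move=> x; rewrite lee_fin sqr_ge0.
Qed.

Let EYY (a : R) (i j : nat) : 0 <= a -> i != j ->
  (\int[P]_w (Y a i w * Y a j w)%:E = (m a * m a)%:E)%E.
Proof.
move=> a0 ij; rewrite EFinM -{1}(EY _ i a0) -(EY _ j a0).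
under eq_integral do rewrite EFinM.
apply: (@ge0_integral_indepM _ _ _ _ _ P (X i) (X j) (fun x => (trunc a x)%:E)
  (fun x => (trunc a x)%:E)) => //.
- by move=> A B; exact: X_ind.
- by apply/measurable_EFinP; exact: measurable_trunc.
- by move=> x; rewrite lee_fin trunc_ge0.
- by apply/measurable_EFinP; exact: measurable_trunc.
- by move=> x; rewrite lee_fin trunc_ge0.
Qed.

(* The truncation level in [m] is the number of terms itself, so that, along a
   dyadic sequence of n, both error terms of [P_bad] sum to O(mu) by
   [sum_dyadic_below] and [sum_dyadic_above]. *)
Let bad (e : R) (n : nat) : set Omega :=
  [set w | e * n%:R <= `|\sum_(i < n) X i w - n%:R * m n%:R|].

Let mbad e n : measurable (bad e n).
Proof.
have mf : measurable_fun [set: Omega]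
    (fun w => `|\sum_(i < n) X i w - n%:R * m n%:R|).
  apply: measurableT_comp => //; apply: measurable_funB => //.
  exact: measurable_sum.
have := mf measurableT `[e * n%:R, +oo[%classic (measurable_itv _).
by congr measurable; apply/seteqP; split => w; rewrite /bad/= in_itv/= andbT//; case.
Qed.

Let mgt (a : R) i : measurable [set w | a < X i w].
Proof.
have := mX i measurableT `]a, +oo[%classic (measurable_itv _).
by congr measurable; apply/seteqP; split => w; rewrite /= in_itv/= andbT//; case.
Qed.

(** Unless some [X i] with [i < n] exceeds [n], truncation at [n] changes nothing. The union bound
    pays for that exception, and Chebyshev at deviation [e * n] for the truncated sum. *)
Let P_bad (e : R) n : 0 < e -> (0 < n)%N ->
  (P (bad e n) <= n%:R%:E * P [set w | (n%:R : R) < X 0%N w]%R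
                  + (s n%:R / (n%:R * e ^+ 2))%:E)%E.
Proof.
move=> e0 n0; have n0' : (0 : R) < n%:R by rewrite ltr0n.
pose B1 := \big[setU/set0]_(i < n) [set w | (n%:R : R) < X i w].
pose B2 := [set w | e * n%:R <= `|\sum_(i < n) Y n%:R i w - n%:R * m n%:R|].
have mB1 : measurable B1 by exact: bigsetU_measurable.
have mB2 : measurable B2.
  have mf : measurable_fun [set: Omega]
      (fun w => `|\sum_(i < n) Y n%:R i w - n%:R * m n%:R|).
    apply: measurableT_comp => //; apply: measurable_funB => //.
    exact: measurable_sum.
  have := mf measurableT `[e * n%:R, +oo[%classic (measurable_itv _).
  by congr measurable; apply/seteqP; split => w; rewrite /B2/= in_itv/= andbT//; case.
apply: (@le_trans _ _ (P (B1 `|` B2))).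
  apply: le_measure; rewrite ?inE//; first exact: measurableU.
  move=> w badw; have [B1w|nB1w] := pselect (B1 w); [by left|right].
  rewrite /B2/=; rewrite (eq_bigr (fun i : 'I_n => X i w))//= => i _.
  rewrite /Y truncE//; case: leP => [_|Xi]; first by rewrite mulr1.
  exfalso; apply: nB1w; rewrite /B1.
  by rewrite -(bigcup_mkord n (fun i => [set w | (n%:R : R) < X i w])); exists i => //=.
apply: (le_trans (measureU2 _ _ _)) => //; apply: leeD.
  apply: le_trans (@Boole_inequality _ _ _ P (fun i => [set w | (n%:R : R) < X i w]) n _) _ => //.
  rewrite (eq_bigr (fun=> P [set w | (n%:R : R) < X 0%N w])); last first.
    move=> i _; have := X_law i _ (measurable_itv `](n%:R : R), +oo[).
    by congr (P _ = P _); apply/seteqP; split => w; rewrite /= in_itv/= andbT//; case.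
  have -> : P [set w | (n%:R : R) < X 0%N w] = (fine (P [set w | (n%:R : R) < X 0%N w]))%:E.
    by rewrite fineK// fin_num_measure.
  by rewrite sumEFin sumr_const card_ord -EFinM mulr_natl.
have := @chebyshev_sum _ _ _ P (Y n%:R) n%:R (m n%:R) (s n%:R)
  (mY n%:R) _ _ _ _ n (e * n%:R).
rewrite -/B2 => /(_ _ _ _ _ _)/le_trans; apply => //.
- by move=> i w; rewrite ger0_norm ?trunc_ge0 ?trunc_le.
- by move=> i; rewrite unlock EY.
- by move=> i; rewrite unlock/= -(EY2 _ i (ltW n0')).
- by move=> i j ij; rewrite unlock/= (EYY _ _ _ _ ij)// ltW.
- by rewrite mulr_gt0.
- rewrite lee_fin le_eqVlt; apply/orP; left; apply/eqP; field.
  by rewrite !gt_eqF.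
Qed.

Let mX0 : measurable_fun [set: Omega] (fun w => (2 * X 0%N w)%:E).
Proof. by apply/measurable_EFinP; exact: measurable_funM. Qed.

Let E2X : (\int[P]_w (2 * X 0%N w)%:E = (2 * mu)%:E)%E.
Proof.
under eq_integral do rewrite EFinM.
rewrite ge0_integralZl//; first by rewrite EX.
- exact/measurable_EFinP.
- by move=> w _; rewrite lee_fin.
Qed.

(** Each term is the expectation of a constant times an indicator; the sum is taken inside the
    integral and bounded pointwise by [sum_dyadic_below]. *)
Let sum_tail (j K : nat) : (0 < j)%N ->
  (\sum_(k < K) (j * 2 ^ k)%:R%:E * P [set w | ((j * 2 ^ k)%:R : R) < X 0%N w]%R
    <= (2 * mu)%:E)%E.
Proof.
move=> j0; have j0' : (0 : R) < j%:R by rewrite ltr0n.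
pose g (k : 'I_K) w : R := j%:R * 2 ^+ k * (j%:R * 2 ^+ k < X 0%N w)%R%:R.
have gE k w : g k w = j%:R * 2 ^+ k * \1_[set w | j%:R * 2 ^+ k < X 0%N w] w.
  by rewrite /g indicE mem_setE.
have mg k : measurable_fun [set: Omega] (fun w => (g k w)%:E).
  apply/measurable_EFinP; rewrite (funext (gE k)).
  by apply: measurable_funM => //; exact: measurable_indic.
have g0 k w : (0 <= (g k w)%:E)%E.
  by rewrite lee_fin mulr_ge0// mulr_ge0 ?exprn_ge0// ltW.
rewrite (eq_bigr (fun k => \int[P]_w (g k w)%:E)%E); last first.
  move=> k _; under eq_integral do rewrite gE EFinM.
  rewrite ge0_integralZl//.
  - by rewrite integral_indic// setIT natrM natrX.
  - by apply/measurable_EFinP; exact: measurable_indic.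
rewrite -ge0_integral_sum// -E2X; apply: ge0_le_integral => //.
- by move=> w _; apply: sume_ge0.
- exact: emeasurable_sum.
- by move=> w _; rewrite sumEFin lee_fin sum_dyadic_below.
Qed.

(** Same exchange of sum and integral, now with [X ^ 2 / N] on the event [X <= N], bounded by
    [sum_dyadic_above]. *)
Let sum_var (j K : nat) : (0 < j)%N ->
  \sum_(k < K) s (j * 2 ^ k)%:R / (j * 2 ^ k)%:R <= 2 * mu.
Proof.
move=> j0; have j0' : (0 : R) < j%:R by rewrite ltr0n.
rewrite -lee_fin -sumEFin.
pose g (k : 'I_K) w : R := X 0%N w ^+ 2 * (X 0%N w <= j%:R * 2 ^+ k)%R%:R / (j%:R * 2 ^+ k).
have gE k w : g k w = (j%:R * 2 ^+ k)^-1 * Y (j%:R * 2 ^+ k) 0 w ^+ 2.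
  rewrite /g /Y truncE// mulrC exprMn; congr (_ * (_ * _)).
  by case: (_ <= _); rewrite ?expr1n// expr0n.
have mg k : measurable_fun [set: Omega] (fun w => (g k w)%:E).
  apply/measurable_EFinP; rewrite (funext (gE k)).
  by apply: measurable_funM => //; exact: measurable_funX.
have Nk0 k : 0 <= (j%:R : R) * 2 ^+ k by rewrite mulr_ge0 ?exprn_ge0// ltW.
have g0 k w : (0 <= (g k w)%:E)%E.
  by rewrite lee_fin gE mulr_ge0 ?invr_ge0// sqr_ge0.
rewrite (eq_bigr (fun k => \int[P]_w (g k w)%:E)%E); last first.
  move=> k _; under eq_integral do rewrite gE EFinM.
  rewrite ge0_integralZl//.
  - by rewrite EY2// -EFinM mulrC natrM natrX.
  - by apply/measurable_EFinP; exact: measurable_funX.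
  - by move=> w _; rewrite lee_fin sqr_ge0.
rewrite -ge0_integral_sum// -E2X; apply: ge0_le_integral => //.
- by move=> w _; apply: sume_ge0.
- exact: emeasurable_sum.
- by move=> w _; rewrite sumEFin lee_fin sum_dyadic_above.
Qed.

Let sum_bad (e : R) (j K : nat) : 0 < e -> (0 < j)%N ->
  (\sum_(k < K) P (bad e (j * 2 ^ k)) <= (2 * mu + 2 * mu / e ^+ 2)%:E)%E.
Proof.
move=> e0 j0.
apply: (@le_trans _ _ (\sum_(k < K) (
    (j * 2 ^ k)%:R%:E * P [set w | ((j * 2 ^ k)%:R : R) < X 0%N w]%R
    + (s (j * 2 ^ k)%:R / ((j * 2 ^ k)%:R * e ^+ 2))%:E))%E).
  by apply: lee_sum => k _; rewrite P_bad// muln_gt0 j0 expn_gt0.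
rewrite big_split/= EFinD leeD//; first exact: sum_tail.
rewrite sumEFin lee_fin.
under eq_bigr do rewrite invfM mulrA.
rewrite -mulr_suml ler_wpM2r//; first by rewrite invr_ge0 sqr_ge0.
exact: sum_var.
Qed.

(** Monotone convergence: the truncated variables increase to [X 0]. *)
Let m_cvg j : (0 < j)%N -> m (j * 2 ^ k)%:R @[k --> \oo] --> mu.
Proof.
move=> j0.
suff H : (\int[P]_w (Y (j * 2 ^ k)%:R 0 w)%:E)%E @[k --> \oo] --> mu%:E.
  apply: fine_cvg; exact: H.
rewrite -EX.
have XE w : (X 0%N w)%:E = limn (fun k => (Y (j * 2 ^ k)%:R 0 w)%:E).
  apply/esym/cvg_lim => //; apply: cvg_EFin; first exact: nearW.
  apply: (@cvg_near_cst).
  (* From this index on, [X 0 w < k <= 2 ^ k <= j * 2 ^ k], so the truncation is inactive. *)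
  exists (Num.truncn (X 0%N w)).+1 => // k /= wk.
  rewrite /Y truncE// (_ : (_ <= _) = true) ?mulr1//.
  rewrite (le_trans (ltW (truncnS_gt _)))// ler_nat.
  rewrite (leq_trans wk)// (leq_trans (ltnW (ltn_expl k (ltnSn 1))))//.
  by rewrite leq_pmull.
under [X in _ --> X]eq_integral do rewrite XE.
apply: cvg_monotone_convergence => //.
- by move=> k; apply/measurable_EFinP.
- by move=> k w _; rewrite lee_fin trunc_ge0.
- move=> w _ k l kl; rewrite lee_fin /Y !truncE// ler_wpM2l//.
  have [Xk|Xk] := leP (X 0%N w) (j * 2 ^ k)%:R; last by rewrite ler0n.
  rewrite (le_trans Xk)// ler_nat leq_mul2l leq_exp2l//.
  by rewrite kl orbT.
Qed.

(** Borel-Cantelli for the countably many tolerances [1 / (q + 1)] controls the distance to the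
    truncated mean, and [m_cvg] the bias of that mean; each gets half of [e]. *)
Lemma slln_dyadic j : (0 < j)%N -> {ae P, forall w,
  (\sum_(i < j * 2 ^ k) X i w) / (j * 2 ^ k)%:R @[k --> \oo] --> mu}.
Proof.
move=> j0.
have : {ae P, forall w, forall q : nat,
    \forall k \near \oo, ~ bad q.+1%:R^-1 (j * 2 ^ k) w}.
  apply/ae_foralln => q; apply: ae_eventually_not => [k|K]; first exact: mbad.
  by apply: sum_bad; rewrite // invr_gt0.
apply: filterS => w H; apply/cvgrPdist_lt => e e0.
have e20 : 0 < e / 2 by rewrite divr_gt0.
have [q _ /(_ q (leqnn q)) qe] := near_infty_natSinv_lt (PosNum e20).
have /cvgrPdist_lt/(_ _ e20) mc := m_cvg j j0.
near=> k.
have n0 : (0 : R) < (j * 2 ^ k)%:R by rewrite ltr0n muln_gt0 j0 expn_gt0.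
have h1 : `|mu - m (j * 2 ^ k)%:R| < e / 2.
  by near: k; exact: mc.
have h2 : ~ bad q.+1%:R^-1 (j * 2 ^ k) w by near: k; exact: H.
move: h2; rewrite /bad/= => /negP; rewrite -ltNge => h2.
have h3 : `|m (j * 2 ^ k)%:R - (\sum_(i < j * 2 ^ k) X i w) / (j * 2 ^ k)%:R| < e / 2.
  rewrite distrC -(@ltr_pM2r _ (j * 2 ^ k)%:R)// -[X in _ * X < _](gtr0_norm n0) -normrM.
  rewrite mulrBl divfK ?gt_eqF// [m _ * _]mulrC (lt_trans h2)// ltr_pM2r//.
by rewrite (le_lt_trans (ler_distD (m (j * 2 ^ k)%:R) _ _))// [e]splitr ltrD.
Unshelve. all: by end_near. Qed.
End dyadic.

(** [J] and [J + B] stand for the multiples of [2 ^ k] around [N]. The products of variables enter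
    as hypotheses, so that linear arithmetic concludes. *)
Lemma avg_sandwich {R : realFieldType} (mu d e Sn J B N : R) : 0 < N -> d <= 1 -> 0 <= B ->
  (mu - d) * J <= Sn -> Sn <= (mu + d) * (J + B) ->
  (mu + 1) * B <= N * (e / 2) -> d * N <= N * (e / 2) ->
  mu * J <= mu * N -> d * J <= d * N -> mu * N <= mu * (J + B) ->
  `|mu - Sn / N| <= e.
Proof.
move=> N0 d1 B0 lo up key dN muJ dJ muJB.
have dB : d * B <= 1 * B by rewrite ler_wpM2r.
rewrite ler_distl; apply/andP; split.
  rewrite lerBlDr ler_pdivrMr//; clear -B0 lo up key dN muJ dJ muJB dB; lra.
rewrite -lerBlDr ler_pdivlMr//; clear -B0 lo up key dN muJ dJ muJB dB; lra.
Qed.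

(* Every n lies between j * 2 ^ k and j.+1 * 2 ^ k for some m <= j < 2 * m, and
   monotonicity costs a factor 1 + 1/m only, where m is arbitrary. *)
Lemma cvg_avg_dyadic {R : realType} (S : nat -> R) (mu : R) :
  {homo S : m n / (m <= n)%N >-> m <= n} -> (forall n, 0 <= S n) ->
  (forall j, (0 < j)%N -> S (j * 2 ^ k)%N / (j * 2 ^ k)%:R @[k --> \oo] --> mu) ->
  S n / n%:R @[n --> \oo] --> mu.
Proof.
move=> Snd S0 Sj.
have mu0 : 0 <= mu.
  have /cvg_lim <- // := Sj 1%N erefl.
  apply: limr_ge; first by apply/cvg_ex; exists mu; exact: Sj.
  by apply: nearW => k; rewrite divr_ge0.
apply/cvgrPdist_le => e e0.
(* [d <= 1] lets the cross term [d * B] of the sandwich be absorbed into [(mu + 1) * B]. *)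
pose d := Num.min 1 (e / 2).
have d0 : 0 < d by rewrite lt_min ltr01 divr_gt0.
have [d1 de] : d <= 1 /\ d <= e / 2 by split; rewrite /d ge_min lexx ?orbT.
(* A block has length [2 ^ k <= n / m]; this [m] makes its cost [(mu + 1) * 2 ^ k] at most
   [n * (e / 2)]. *)
pose m := (Num.truncn ((mu + 1) / (e / 2))).+1.
have m0 : (0 : R) < m%:R by rewrite ltr0n.
have me : mu + 1 <= m%:R * (e / 2).
  by rewrite -ler_pdivrMr ?divr_gt0// ltW// truncnS_gt.
(* Only finitely many [j] occur, so the limits are uniform in [j]; the range includes [2 * m]
   because [j.+1] is used as well. *)
have : \forall k \near \oo, forall j : 'I_(2 * m).+1, (0 < j)%N ->
    `|mu - S (j * 2 ^ k)%N / (j * 2 ^ k)%:R| < d.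
  apply: filter_forall => j; have [->|j0] := posnP j; first exact: nearW.
  by have /cvgrPdist_lt/(_ _ d0) := Sj _ j0; apply: filterS.
case=> K _ HK.
exists (m * 2 ^ K)%N => // n /= nK.
have n0 : (0 < n)%N by rewrite (leq_trans _ nK)// muln_gt0 expn_gt0.
(* The largest [k] with [m * 2 ^ k <= n], which forces [n %/ 2 ^ k] into [[m, 2 * m)]. *)
pose k := trunc_log 2 (n %/ m).
have nm0 : (0 < n %/ m)%N.
  by rewrite divn_gt0// (leq_trans _ nK)// leq_pmulr// expn_gt0.
have kn : (2 ^ k * m <= n)%N by rewrite -leq_divRL// trunc_logP.
have nk : (n < 2 ^ k.+1 * m)%N by rewrite -ltn_divLR// trunc_log_ltn.
have Kk : (K <= k)%N.
  by rewrite trunc_log_max// leq_divRL// mulnC.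
pose j := (n %/ 2 ^ k)%N.
have k0 : (0 < 2 ^ k)%N by rewrite expn_gt0.
have mj : (m <= j)%N by rewrite leq_divRL// mulnC.
have j2m : (j < 2 * m)%N by rewrite ltn_divLR// mulnAC -expnS.
have jn : (j * 2 ^ k <= n)%N by exact: leq_trunc_div.
have nj : (n <= j.+1 * 2 ^ k)%N by rewrite ltnW// ltn_ceil.
have lo : `|mu - S (j * 2 ^ k)%N / (j * 2 ^ k)%:R| < d.
  by have := HK k Kk (Ordinal (ltnW j2m : j < (2 * m).+1)%N); apply; exact: leq_trans mj.
have up : `|mu - S (j.+1 * 2 ^ k)%N / (j.+1 * 2 ^ k)%:R| < d.
  by have := HK k Kk (Ordinal (j2m : j.+1 < (2 * m).+1)%N); apply.
have N0 : (0 : R) < (j * 2 ^ k)%:R.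
  by rewrite ltr0n muln_gt0 k0 (leq_trans _ mj).
have N1 : (0 : R) < (j.+1 * 2 ^ k)%:R by rewrite ltr0n muln_gt0 k0.
have n0' : (0 : R) < n%:R by rewrite ltr0n.
have lo' : (mu - d) * (j * 2 ^ k)%:R <= S n.
  apply: le_trans (Snd _ _ jn); rewrite -ler_pdivlMr//.
  by move: lo; rewrite ltr_distl => /andP[/ltW]; lra.
have up' : S n <= (mu + d) * (j.+1 * 2 ^ k)%:R.
  apply: (le_trans (Snd _ _ nj)); rewrite -ler_pdivrMr//.
  by move: up; rewrite ltr_distl => /andP[/ltW + _]; rewrite lerBlDr.
have jE : (j.+1 * 2 ^ k)%:R = (j * 2 ^ k)%:R + (2 ^ k)%:R :> R.
  by rewrite -natrD mulSn addnC.
have jn' : (j * 2 ^ k)%:R <= n%:R :> R by rewrite ler_nat.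
have nj' : n%:R <= (j.+1 * 2 ^ k)%:R :> R by rewrite ler_nat.
have kn' : (2 ^ k)%:R * m%:R <= n%:R :> R by rewrite -natrM ler_nat.
have k0' : (0 : R) <= (2 ^ k)%:R by rewrite ler0n.
have key : (mu + 1) * (2 ^ k)%:R <= n%:R * (e / 2).
  apply: (@le_trans _ _ (m%:R * (e / 2) * (2 ^ k)%:R)); first by rewrite ler_wpM2r.
  rewrite mulrAC ler_wpM2r//; [by rewrite divr_ge0 ?(ltW e0)|by rewrite mulrC].
have dn : d * n%:R <= n%:R * (e / 2) by rewrite mulrC ler_wpM2l// ltW.
move: jE nj' up' => -> nj' up'.
have muj : mu * (j * 2 ^ k)%:R <= mu * n%:R by rewrite ler_wpM2l.
have dj : d * (j * 2 ^ k)%:R <= d * n%:R by rewrite ler_wpM2l// ltW.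
have muj' : mu * n%:R <= mu * ((j * 2 ^ k)%:R + (2 ^ k)%:R) by rewrite ler_wpM2l.
exact: (avg_sandwich mu d e _ _ _ _ n0' d1 k0' lo' up' key dn muj dj muj').
Qed.

Section slln.
Context {R : realType} {dO : measure_display} {Omega : measurableType dO}.
Variable (P : probability Omega R).

(** Independence in pairs is the natural form here: the argument uses it only through
    covariances. *)
Definition pairwise_iid (X : nat -> Omega -> R) :=
  [/\ forall i, measurable_fun [set: Omega] (X i),
      forall i B, measurable B -> P (X i @^-1` B) = P (X 0%N @^-1` B) &
      forall i j, i != j -> forall A B, measurable A -> measurable B ->
        P (X i @^-1` A `&` X j @^-1` B) = (P (X i @^-1` A) * P (X j @^-1` B))%E].

Lemma pairwise_iid_comp X (h : R -> R) : measurable_fun [set: R] h ->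
  pairwise_iid X -> pairwise_iid (fun i => h \o X i).
Proof.
move=> mh [mX lX iX]; have mhB B : measurable B -> measurable (h @^-1` B).
  by move=> mB; rewrite -[X in measurable X]setTI; exact: mh.
split=> [i|i B mB|i j ij A B mA mB]; first exact: measurableT_comp.
- exact: (lX i _ (mhB _ mB)).
- exact: (iX i j ij _ _ (mhB _ mA) (mhB _ mB)).
Qed.

Lemma slln_ge0 X (mu : R) : pairwise_iid X -> (forall i w, 0 <= X i w) ->
  (\int[P]_w (X 0%N w)%:E = mu%:E)%E ->
  {ae P, forall w, (\sum_(i < n) X i w) / n%:R @[n --> \oo] --> mu}.
Proof.
move=> [mX lX iX] X0 EX.
have : {ae P, forall w, forall j,
    (\sum_(i < j.+1 * 2 ^ k) X i w) / (j.+1 * 2 ^ k)%:R @[k --> \oo] --> mu}.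
  by apply/ae_foralln => j; exact: slln_dyadic.
apply: filterS => w Hw.
apply: (@cvg_avg_dyadic _ (fun n => \sum_(i < n) X i w)).
- move=> p q pq; rewrite -(subnKC pq) big_split_ord/= lerDl.
  exact: sumr_ge0.
- by move=> n; exact: sumr_ge0.
- by case=> // j _; exact: Hw.
Qed.

(** Positive and negative parts are again pairwise i.i.d., being functions of the [X i]; each has
    finite mean and falls under [slln_ge0]. *)
Theorem slln X : pairwise_iid X -> P.-integrable setT (EFin \o X 0%N) ->
  {ae P, forall w, (\sum_(i < n) X i w) / n%:R @[n --> \oo] -->
                   fine (\int[P]_w (X 0%N w)%:E)}.
Proof.
move=> iid intX.
have mp : measurable_fun [set: R] (fun x => Num.max x 0) by exact: measurable_maxr.
have mn : measurable_fun [set: R] (fun x => Num.max (- x) 0).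
  exact: measurable_maxr.
pose Xp i w := Num.max (X i w) 0; pose Xn i w := Num.max (- X i w) 0.
have ip : (\int[P]_w (Xp 0%N w)%:E)%E \is a fin_num.
  have := integrable_funepos measurableT intX => /integrable_fin_num -/(_ measurableT).
  by congr (_ \is a fin_num); apply: eq_integral => w _; rewrite /Xp funeposE/= EFin_max.
have iN : (\int[P]_w (Xn 0%N w)%:E)%E \is a fin_num.
  have := integrable_funeneg measurableT intX => /integrable_fin_num -/(_ measurableT).
  by congr (_ \is a fin_num); apply: eq_integral => w _; rewrite /Xn funenegE/= EFin_max.
have Xp_cvg : {ae P, forall w, (\sum_(i < n) Xp i w) / n%:R @[n --> \oo] -->
    fine (\int[P]_w (Xp 0%N w)%:E)}.
  apply: slln_ge0; first exact: (pairwise_iid_comp _ _ mp iid).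
    by move=> i w; rewrite /Xp le_max lexx orbT.
  by rewrite fineK.
have Xn_cvg : {ae P, forall w, (\sum_(i < n) Xn i w) / n%:R @[n --> \oo] -->
    fine (\int[P]_w (Xn 0%N w)%:E)}.
  apply: slln_ge0; first exact: (pairwise_iid_comp _ _ mn iid).
    by move=> i w; rewrite /Xn le_max lexx orbT.
  by rewrite fineK.
have -> : (\int[P]_w (X 0%N w)%:E =
    \int[P]_w (Xp 0%N w)%:E - \int[P]_w (Xn 0%N w)%:E)%E.
  rewrite integralE; congr (_ - _)%E; apply: eq_integral => w _.
    by rewrite /Xp funeposE EFin_max.
  by rewrite /Xn funenegE EFin_max.
rewrite fineB//; move: Xp_cvg Xn_cvg; apply: filterS2 => w Xpw Xnw.
rewrite (_ : (fun n => _) = (fun n => (\sum_(i < n) Xp i w) / n%:R)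
  \- (fun n => (\sum_(i < n) Xn i w) / n%:R)); first exact: cvgB.
apply/funext => n /=.
rewrite -mulrBl -sumrB; congr (_ / _); apply: eq_bigr => i _.
by rewrite /Xp /Xn; case: (leP (X i w) 0); case: (leP (- X i w) 0); lra.
Qed.
End slln.

(** * Log-likelihoods under a density *)

Section density.
Context {R : realType} {dX : measure_display} {X : measurableType dX}.
Variables (nu Q : {measure set X -> \bar R}) (f : X -> R).
Hypotheses (f0 : forall x, 0 <= f x) (mf : measurable_fun [set: X] f)
  (Qf : forall B, measurable B -> Q B = (\int[nu]_(x in B) (f x)%:E)%E).

Import HBNNSimple.

(** Change of measure [dQ = f dnu]: it holds for indicators by [Qf], for simple functions by
    linearity, and in the limit by monotone convergence on both sides. *)
Lemma ge0_integral_density (g : X -> \bar R) :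
  measurable_fun [set: X] g -> (forall x, 0 <= g x)%E ->
  (\int[Q]_x g x = \int[nu]_x (g x * (f x)%:E))%E.
Proof.
move=> mg g0.
pose h := nnsfun_approx measurableT mg.
have mEf : measurable_fun [set: X] (EFin \o f) by exact/measurable_EFinP.
have gE x : g x = limn (fun n => (h n x)%:E).
  by apply/esym/cvg_lim => //; exact: cvg_nnsfun_approx.
have gfE x : (g x * (f x)%:E = limn (fun n => (h n x)%:E * (f x)%:E))%E.
  apply/esym/cvg_lim => //; apply: cvgeZr => //.
  exact: cvg_nnsfun_approx.
under eq_integral do rewrite gE.
under [RHS]eq_integral do rewrite gfE.
rewrite monotone_convergence//; first last.
- by move=> x _ a b ab; rewrite lee_fin; exact/lefP/nd_nnsfun_approx.
- by move=> n x _; rewrite lee_fin.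
- by move=> n; exact/measurable_EFinP.
rewrite monotone_convergence//; first last.
- move=> x _ a b ab; rewrite lee_wpmul2r ?lee_fin//.
  exact/lefP/nd_nnsfun_approx.
- by move=> n x _; rewrite mule_ge0 ?lee_fin.
- by move=> n; apply: emeasurable_funM => //; exact/measurable_EFinP.
congr (limn _); apply/funext => n.
have mi r : measurable_fun [set: X] (fun x => (r * \1_(h n @^-1` [set r]) x)%:E).
  by apply/measurable_EFinP; exact: measurable_funM.
under eq_integral do rewrite fimfunE -fsumEFin//.
rewrite ge0_integral_fsum//; last by move=> m y _; exact: nnfun_muleindic_ge0.
under [RHS]eq_integral => x _.
  rewrite fimfunE -fsumEFin// ge0_mule_fsuml; last by move=> y; exact: nnfun_muleindic_ge0.
  over.
rewrite ge0_integral_fsum//; first last.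
- by move=> m y _; rewrite mule_ge0 ?lee_fin// -lee_fin; exact: nnfun_muleindic_ge0.
- by move=> y; exact: emeasurable_funM.
apply: eq_fsbigr => r rh.
under eq_integral do rewrite EFinM.
rewrite integralZl_indic_nnsfun//.
under [RHS]eq_integral do rewrite EFinM -muleA.
rewrite ge0_integralZl//.
- under [in RHS]eq_integral do rewrite muleC.
  rewrite [in RHS](eq_integral ((EFin \o f) \_ (h n @^-1` [set r]))); last first.
    by move=> x _; rewrite epatch_indic.
  by rewrite -integral_mkcond -Qf// integral_indic// setIT.
- by apply: emeasurable_funM => //; exact/measurable_EFinP.
- by move=> x _; rewrite mule_ge0 ?lee_fin.
- by move: rh; rewrite inE => -[x _ <-]; rewrite lee_fin.
Qed.

Lemma integral_density (g : X -> R) : measurable_fun [set: X] g ->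
  (\int[Q]_x (g x)%:E = \int[nu]_x (g x * f x)%:E)%E.
Proof.
move=> mg; have mEg : measurable_fun [set: X] (EFin \o g) by exact/measurable_EFinP.
rewrite integralE [RHS]integralE; congr (_ - _)%E.
  rewrite ge0_integral_density; last 2 first.
  - exact: measurable_funepos.
  - by [].
  apply: eq_integral => x _; rewrite !funeposE -!EFin_max -EFinM maxr_pMl//.
  by rewrite mul0r.
rewrite ge0_integral_density; last 2 first.
- exact: measurable_funeneg.
- by [].
apply: eq_integral => x _; rewrite !funenegE -!EFinN -!EFin_max -EFinM maxr_pMl//.
by rewrite mul0r mulNr.
Qed.

Lemma integrable_density (g : X -> R) : measurable_fun [set: X] g ->
  nu.-integrable setT (fun x => (g x * f x)%:E) ->
  Q.-integrable setT (EFin \o g).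
Proof.
move=> mg /integrableP[_ gf]; apply/integrableP; split; first exact/measurable_EFinP.
rewrite ge0_integral_density//; last first.
  by apply: measurableT_comp => //; exact/measurable_EFinP.
apply: le_lt_trans gf; rewrite le_eqVlt; apply/orP; left; apply/eqP.
by apply: eq_integral => x _; rewrite /= normrM (ger0_norm (f0 x)).
Qed.
End density.

Lemma mutually_independent_pair {dO dT : measure_display} {R : realType}
  {Omega : measurableType dO} {T : measurableType dT}
  (P : probability Omega R) (Y : nat -> Omega -> T) :
  mutually_independent P Y -> forall i j, i != j ->
  forall A B, measurable A -> measurable B ->
  P (Y i @^-1` A `&` Y j @^-1` B) = (P (Y i @^-1` A) * P (Y j @^-1` B))%E.
Proof.
move=> indY i j ij A B mA mB.
(* Only the sets at [i] and [j] matter, so every index other than [i] may receive [B]. *)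
have := indY [:: i; j] (fun k => if k == i then A else B).
rewrite /= inE ij => /(_ erefl) H.
have {H} := H _; rewrite big_cons big_seq1 eqxx eq_sym (negbTE ij) => <-.
- congr (P _); apply/seteqP; split=> w /=.
    by move=> [wi wj] k /=; rewrite !inE => /orP[]/eqP->; rewrite ?eqxx// eq_sym (negbTE ij).
  move=> H; split; first by have := H i; rewrite /= !inE eqxx; apply.
  by have := H j; rewrite /= !inE eqxx orbT eq_sym (negbTE ij); apply.
- by move=> k; case: ifP.
Qed.

(** * Strong law for the log-likelihood ratios of a single agent *)

Section agent.
Context {R : realType} {dO dX : measure_display} {Omega : measurableType dO}
  {X : measurableType dX}.
Variables (P : probability Omega R) (nu : {measure set X -> \bar R})
  (f L : X -> R) (xi : nat -> Omega -> X).
Hypotheses (f0 : forall x, 0 <= f x) (mf : measurable_fun [set: X] f)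
  (L0 : forall x, 0 <= L x) (mL : measurable_fun [set: X] L)
  (mxi : forall i, measurable_fun [set: Omega] (xi i))
  (indxi : mutually_independent P xi)
  (lawxi : forall i B, measurable B ->
    P (xi i @^-1` B) = (\int[nu]_(x in B) (f x)%:E)%E)
  (KLfin : KL nu f L \is a fin_num).

(** A real-valued log-likelihood ratio: where a density vanishes, [ln] takes a real default value
    instead of an infinite one. *)
Let h x := ln (f x) - ln (L x).

Let mh : measurable_fun [set: X] h.
Proof.
by apply: measurable_funB; apply: (measurableT_comp (@measurable_ln R)).
Qed.

Let kl x := kl_integrand (f x) (L x).

Let klE x : kl x = if f x == 0 then 0%E else
  if L x == 0 then +oo%E else (h x * f x)%:E.
Proof.
rewrite /kl /kl_integrand; case: ifPn => // fx; case: ifPn => // Lx.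
by rewrite mulrC ln_div// posrE lt_neqAle eq_sym ?fx ?Lx/= ?f0 ?L0.
Qed.

Let mkl : measurable_fun [set: X] kl.
Proof.
rewrite (funext klE); apply: measurable_fun_ifT => //.
  exact: measurable_fun_eqr.
apply: measurable_fun_ifT => //; first exact: measurable_fun_eqr.
by apply/measurable_EFinP; exact: measurable_funM.
Qed.

(** The integral is the difference of those of the positive and negative parts. A difference with an
    infinite term is infinite, even [+oo - +oo] by convention, so a finite value bounds both. *)
Let intkl : nu.-integrable setT kl.
Proof.
have : KL nu f L \is a fin_num by [].
rewrite /KL -/kl integralE => H.
apply/integrableP; split => //.
rewrite -[fun x => _]/(abse \o kl) fune_abse.
rewrite ge0_integralD//; last 2 first.
- exact: measurable_funepos.
- exact: measurable_funeneg.
have p0 : (0 <= \int[nu]_x kl^\+ x)%E by exact: integral_ge0.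
have n0 : (0 <= \int[nu]_x kl^\- x)%E by exact: integral_ge0.
move: H p0 n0.
by case: (\int[nu]_x kl^\+ x)%E => [a| |]//; case: (\int[nu]_x kl^\- x)%E => [b| |]//;
  rewrite /= ltry.
Qed.

Let mzero (g : X -> R) : measurable_fun [set: X] g -> measurable [set x | g x = 0].
Proof.
by move=> mg; have := mg measurableT [set 0] (measurable_set1 _); rewrite setTI.
Qed.

Let null := [set x | f x != 0 /\ L x = 0].

Let mnull : measurable null.
Proof.
have -> : null = ~` [set x | f x = 0] `&` [set x | L x = 0].
  by apply/seteqP; split => x /= [] => [/eqP|/eqP].
by apply: measurableI; [apply: measurableC|]; exact: mzero.
Qed.

(** The integrand is [+oo] on [null], and an integrable function is finite almost everywhere. *)
Let nu_null : nu null = 0%E.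
Proof.
apply/negligibleP => //.
have := integrable_ae measurableT intkl; apply: negligibleS => x [/= fx Lx].
by move=> /(_ Logic.I); rewrite klE (negbTE fx) Lx eqxx.
Qed.

Let ae_ok : {ae nu, forall x, ~ null x}.
Proof. by exists null; split => // x /= /contrapT. Qed.

Let intkl_h : nu.-integrable setT (fun x => (h x * f x)%:E) /\
  (\int[nu]_x (h x * f x)%:E = KL nu f L)%E.
Proof.
have mhf : measurable_fun [set: X] (fun x => (h x * f x)%:E).
  by apply/measurable_EFinP; exact: measurable_funM.
have E : ae_eq nu setT kl (fun x => (h x * f x)%:E).
  apply: filterS ae_ok => x nx _; rewrite klE.
  have [->|fx] := eqVneq (f x) 0; first by rewrite mulr0.
  by case: eqVneq => // Lx; exfalso; exact: nx.
split; last by rewrite /KL; apply/esym/ae_eq_integral.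
apply/integrableP; split => //.
have /integrableP[_] := intkl; apply: le_lt_trans.
rewrite le_eqVlt; apply/orP; left; apply/eqP/ae_eq_integral => //.
- exact: measurableT_comp.
- exact: measurableT_comp.
- by apply: filterS E => x Ex _ /=; rewrite Ex.
Qed.

(** Under the law [f dnu], the set where [f] vanishes has mass zero, and the set where [L] vanishes
    meets the rest only in [null]. *)
Lemma ae_likelihood_gt0 :
  {ae P, forall w, forall i, 0 < f (xi i w) /\ 0 < L (xi i w)}.
Proof.
apply/ae_foralln => i.
pose B := [set x | f x = 0] `|` [set x | L x = 0].
have mB : measurable B by apply: measurableU; exact: mzero.
exists (xi i @^-1` B); split.
- by rewrite -[X in measurable X]setTI; exact: mxi.
- apply: (etrans (lawxi i B mB)); rewrite integral_mkcond -(integral0 nu setT).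
  apply: ae_eq_integral => //.
    apply: (measurable_restrictT _ mB).1; apply: measurable_funTS.
    exact/measurable_EFinP.
  apply: filterS ae_ok => x nx _; rewrite patchE; case: ifPn => // /set_mem[/=->//|/= Lx].
  have [->//|fx] := eqVneq (f x) 0.
  by exfalso; exact: nx.
- move=> w /= nw; apply: contrapT => nB; apply: nw.
  have fn0 : f (xi i w) != 0 by apply/eqP => H; apply: nB; left.
  have Ln0 : L (xi i w) != 0 by apply/eqP => H; apply: nB; right.
  by rewrite !lt_neqAle ![0 == _]eq_sym fn0 Ln0 f0 L0.
Qed.

Lemma slln_log_likelihood :
  {ae P, forall w, (\sum_(i < n) (ln (f (xi i w)) - ln (L (xi i w)))) / n%:R
     @[n --> \oo] --> fine (KL nu f L)}.
Proof.
have [inth <-] := intkl_h.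
pose xi0 := mfun_Sub (mem_set (mxi 0)).
have lawQ B : measurable B ->
    distribution P xi0 B = (\int[nu]_(x in B) (f x)%:E)%E.
  by move=> mB; rewrite -(lawxi 0).
rewrite -(integral_density nu (distribution P xi0) f f0 mf lawQ h mh).
have intQ := integrable_density nu (distribution P xi0) f f0 mf lawQ h mh inth.
have intP : P.-integrable setT (EFin \o (h \o xi 0)).
  have mEh : measurable_fun [set: X] (EFin \o h) by exact/measurable_EFinP.
  apply/integrableP; split; first exact/measurable_EFinP/measurableT_comp.
  have /integrableP[_] := intQ.
  rewrite (@ge0_integral_distribution _ _ _ _ _ P xi0 (fun x => `|(EFin \o h) x|%E))//.
  exact: measurableT_comp.
rewrite (@integral_distribution _ _ _ _ _ P xi0 (EFin \o h))//=; last first.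
  exact/measurable_EFinP.
apply: (slln P (fun i => h \o xi i)) => //.
have mhB C : measurable C -> measurable (h @^-1` C).
  by move=> mC; rewrite -[X in measurable X]setTI; exact: mh.
split=> [i|i B mB|i j ij A B mA mB]; first exact: measurableT_comp.
  by rewrite (lawxi i _ (mhB _ mB)) (lawxi 0 _ (mhB _ mB)).
exact: (mutually_independent_pair P xi indxi i j ij _ _ (mhB _ mA) (mhB _ mB)).
Qed.
End agent.

(** * Linear growth of affine recursions *)

Definition sublinear {R : realType} (u : nat -> R) := u n / n%:R @[n --> \oo] --> (0 : R).

Section sublinear.
Context {R : realType}.
Implicit Types (u v : nat -> R).

Lemma sublinearD u v : sublinear u -> sublinear v -> sublinear (u \+ v).
Proof.
move=> su sv; rewrite /sublinear (_ : (fun n => _) =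
  (fun n => u n / n%:R) \+ (fun n => v n / n%:R)); last first.
  by apply/funext => n /=; rewrite mulrDl.
by rewrite -[0]addr0; exact: cvgD.
Qed.

Lemma sublinearZ (c : R) u : sublinear u -> sublinear (fun n => c * u n).
Proof.
move=> su; rewrite /sublinear; under eq_fun do rewrite -mulrA.
have H : (fun n => c * (u n / n%:R)) @ \oo --> c * 0.
  by apply: cvgM => //; exact: cvg_cst.
by rewrite mulr0 in H.
Qed.

Lemma sublinear_sum (I : Type) (r : seq I) (u : I -> nat -> R) :
  (forall i, sublinear (u i)) -> sublinear (fun n => \sum_(i <- r) u i n).
Proof.
move=> su; elim: r => [|i r IH].
  rewrite /sublinear; under eq_fun do rewrite big_nil mul0r.
  exact: cvg_cst.
rewrite (_ : (fun n => _) = u i \+ (fun n => \sum_(i <- r) u i n)).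
  exact: sublinearD.
by apply/funext => n; rewrite big_cons.
Qed.

Lemma sublinear_norm u : sublinear u <-> sublinear (fun n => `|u n|).
Proof.
rewrite /sublinear; split=> [/cvg_norm|]; [rewrite normr0|move=> H].
  by under eq_fun do rewrite normrM normfV (ger0_norm (ler0n _ _)).
apply/cvgr0Pnorm_lt => e e0; move/cvgr0Pnorm_lt/(_ e e0): H.
by apply: filterS => n; rewrite !normrM normr_id.
Qed.

Lemma sublinear_le u v : (forall n, `|u n| <= v n) -> sublinear v -> sublinear u.
Proof.
move=> uv /cvgr0Pnorm_lt sv; apply/cvgr0Pnorm_lt => e e0; move: (sv e e0).
apply: filterS => n; apply: le_lt_trans; rewrite !normrM ler_wpM2r//.
exact: le_trans (uv n) (ler_norm _).
Qed.

Lemma sublinear_cst (c : R) : sublinear (fun=> c).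
Proof.
have H : (fun n => c * n%:R^-1) @ \oo --> c * 0.
  apply: cvgM; first exact: cvg_cst.
  by rewrite -(cvg_shiftS (fun n => (n%:R^-1 : R))); exact: cvg_harmonic.
by rewrite mulr0 in H.
Qed.

Lemma sublinear_shift m u : sublinear u -> sublinear (fun n => u (n + m)%N).
Proof.
move=> su; apply/cvgr0Pnorm_lt => e e0.
have e20 : 0 < e / 2 by rewrite divr_gt0.
move/cvgr0Pnorm_lt/(_ _ e20) : su => [N _ HN].
exists (N + m.+1)%N => // n /= Nn.
have n0 : (0 < n)%N by lia.
have Nnm : (N <= n + m)%N by lia.
have := HN _ Nnm => /=.
rewrite !normrM !normfV !(ger0_norm (ler0n _ _)).
rewrite ltr_pdivrMr ?ltr0n ?addn_gt0 ?n0// ltr_pdivrMr ?ltr0n// => /lt_le_trans; apply.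
have : (n + m)%:R <= 2 * n%:R :> R by rewrite -natrM ler_nat; lia.
nra.
Qed.

Lemma sublinear_avg u (a : R) :
  sublinear (fun n => u n - n%:R * a) <-> u n / n%:R @[n --> \oo] --> a.
Proof.
(* At [n = 0] division by zero gives 0 on the left and [- a] on the right, hence the thresholds
   [N.+1] below. *)
have E : forall n : nat, (0 < n)%N -> (u n - n%:R * a) / n%:R = u n / n%:R - a.
  by move=> n n0; rewrite mulrBl mulrAC divff ?mul1r// pnatr_eq0 -lt0n.
split=> [/cvgr0Pnorm_lt H|/cvgrPdist_lt H].
  apply/cvgrPdist_lt => e e0; have [N _ HN] := H e e0.
  exists N.+1 => // n /= Nn; rewrite distrC -E; last exact: leq_ltn_trans Nn.
  exact: (HN n (ltnW Nn)).
apply/cvgr0Pnorm_lt => e e0; have [N _ HN] := H e e0.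
exists N.+1 => // n /= Nn; rewrite E; last exact: leq_ltn_trans Nn.
rewrite distrC; exact: (HN n (ltnW Nn)).
Qed.

(** The bound [a n <= e / 2 * n + C] propagates in steps of [m]: contraction keeps a fraction [q] of
    it, and [r] eventually fits into the remaining fraction [1 - q] of the slope. *)
Lemma sublinear_contraction (a r : nat -> R) (q : R) (m : nat) : (0 < m)%N ->
  0 <= q < 1 -> (forall n, 0 <= a n) -> (forall n, a (n + m)%N <= q * a n + r n) ->
  sublinear r -> sublinear a.
Proof.
move=> m0 /andP[q0 q1] a0 ar sr; apply/cvgr0Pnorm_le => e e0.
have e2 : 0 < (1 - q) * (e / 2) by rewrite mulr_gt0 ?subr_gt0 ?divr_gt0.
move/cvgr0Pnorm_lt/(_ _ e2) : sr => [N _ HN].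
(* Dominates every [a n] in the base case, which must span [m] indices past [N] for steps of length
   [m]. *)
pose C := \sum_(i < N.+1 + m) a i.
have C0 : 0 <= C by exact: sumr_ge0.
have bound n : (N < n)%N -> a n <= e / 2 * n%:R + C.
  elim/ltn_ind: n => n IH Nn.
  have [nm|mn] := ltnP n (N.+1 + m).
    have : a n <= C by rewrite /C (bigD1 (Ordinal nm))//= lerDl sumr_ge0.
    have : 0 <= e / 2 * n%:R by rewrite mulr_ge0 ?divr_ge0 ?(ltW e0).
    by lra.
  have En : n = (n - m + m)%N by rewrite subnK//; lia.
  have Nk : (N < n - m)%N by lia.
  have := IH (n - m)%N; rewrite ltn_subrL m0 (leq_ltn_trans _ Nn)// => /(_ erefl Nk) IHk.
  have rk : r (n - m)%N <= (1 - q) * (e / 2) * (n - m)%:R.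
    have k0 : (0 : R) < (n - m)%:R by rewrite ltr0n; lia.
    rewrite -ler_pdivrMr//; apply: le_trans (ler_norm _) _.
    by apply/ltW/HN => /=; lia.
  rewrite {1}En (le_trans (ar _))//.
  have h1 : q * a (n - m)%N <= q * (e / 2 * (n - m)%:R + C) by rewrite ler_wpM2l.
  have h2 : q * C <= 1 * C by rewrite ler_wpM2r// ltW.
  have h3 : e / 2 * (n - m)%:R <= e / 2 * n%:R.
    by rewrite ler_wpM2l ?divr_ge0 ?(ltW e0)// ler_nat leq_subr.
  move: (e / 2) (a (n - m)%N) (r (n - m)%N) ((n - m)%:R : R) (n%:R : R) rk h1 h2 h3.
  by clear=> e2 ak rk k n; lra.
near=> n.
have n0 : (0 : R) < n%:R by rewrite ltr0n; near: n; exists 1%N.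
rewrite normrM normfV (ger0_norm (ler0n _ _)) (ger0_norm (a0 n)) ler_pdivrMr//.
have Nn : (N < n)%N by near: n; exists N.+1.
have Cn : C <= e / 2 * n%:R.
  rewrite mulrC -ler_pdivrMr ?divr_gt0//; near: n; exact: nbhs_infty_ger.
by have := bound n Nn; lra.
Unshelve. all: by end_near. Qed.
End sublinear.

(** * Vector recursions, for row vectors multiplied on the right *)

Definition vsublinear {R : realType} {n : nat} (u : nat -> 'rV[R]_n) :=
  forall j, sublinear (fun k => u k 0 j).

Definition vnorm {R : realType} {n : nat} (v : 'rV[R]_n) : R :=
  \big[Num.max/0]_j `|v 0 j|.

Section vsublinear.
Context {R : realType}.

Lemma vnorm_ge {n} (v : 'rV[R]_n) j : `|v 0 j| <= vnorm v.
Proof. exact: (le_bigmax _ (fun j => `|v 0 j|)). Qed.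

Lemma vnorm_ge0 {n} (v : 'rV[R]_n) : 0 <= vnorm v.
Proof. exact: bigmax_ge_id. Qed.

Lemma vnorm_le {n} (v : 'rV[R]_n) (b : R) :
  0 <= b -> (forall j, `|v 0 j| <= b) -> vnorm v <= b.
Proof. by move=> b0 vb; apply: bigmax_le => // j _; exact: vb. Qed.

Lemma vsublinearD {n} (u v : nat -> 'rV[R]_n) :
  vsublinear u -> vsublinear v -> vsublinear (fun k => u k + v k).
Proof.
move=> su sv j; rewrite (_ : (fun k => _) = (fun k => u k 0 j) \+ (fun k => v k 0 j)).
  exact: sublinearD.
by apply/funext => k; rewrite mxE.
Qed.

Lemma vsublinear_mulmx {n p} (u : nat -> 'rV[R]_n) (M : 'M[R]_(n, p)) :
  vsublinear u -> vsublinear (fun k => u k *m M).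
Proof.
move=> su j; rewrite (_ : (fun k => _) = (fun k => \sum_i M i j * u k 0 i)).
  by apply: sublinear_sum => i; exact: sublinearZ.
by apply/funext => k; rewrite mxE; apply: eq_bigr => i _; rewrite mulrC.
Qed.

Lemma vsublinearN {n} (u : nat -> 'rV[R]_n) :
  vsublinear u -> vsublinear (fun k => - u k).
Proof.
move=> /(vsublinear_mulmx _ (-1)%:M); congr vsublinear.
by apply/funext => k; rewrite mul_mx_scalar scaleN1r.
Qed.

Lemma vsublinear_cst {n} (v : 'rV[R]_n) : vsublinear (fun=> v).
Proof. by move=> j; exact: sublinear_cst. Qed.

Lemma vsublinear_shift {n} m (u : nat -> 'rV[R]_n) :
  vsublinear u -> vsublinear (fun k => u (k + m)%N).
Proof. by move=> su j; exact: (sublinear_shift m _ (su j)). Qed.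

(** Unrolling [m] steps leaves a sublinear perturbation [rho], so the scalar lemma applies to the
    sup norm. Contraction is asked only along the orbit [u], which allows orbits confined to a
    subspace. *)
Lemma vsublinear_contraction {n} (M : 'M[R]_n) (u r : nat -> 'rV[R]_n) (m : nat) (q : R) :
  (0 < m)%N -> 0 <= q < 1 -> (forall k, u k.+1 = u k *m M + r k) -> vsublinear r ->
  (forall k, vnorm (u k *m M ^+ m) <= q * vnorm (u k)) -> vsublinear u.
Proof.
move=> m0 q01 ur sr uq.
have [rho [srho urho]] : exists rho : nat -> 'rV[R]_n, vsublinear rho /\
    forall k, u (k + m)%N = u k *m M ^+ m + rho k.
  elim: {m0 uq} m => [|m [rho [srho urho]]].
    exists (fun=> 0); split=> [|k]; first exact: vsublinear_cst.
    by rewrite addn0 expr0 mulmx1 addr0.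
  exists (fun k => rho k *m M + r (k + m)%N); split.
    by apply: vsublinearD; [exact: vsublinear_mulmx|exact: vsublinear_shift].
  move=> k; rewrite addnS ur urho mulmxDl -addrA; congr (_ + _).
  by rewrite -mulmxA exprSr.
have su : sublinear (fun k => vnorm (u k)).
  apply: (@sublinear_contraction _ _ (fun k => \sum_j `|rho k 0 j|) q m) => //.
  - by move=> k; exact: vnorm_ge0.
  - move=> k; apply: vnorm_le => [|j].
      rewrite addr_ge0 ?sumr_ge0// mulr_ge0 ?vnorm_ge0//; by case/andP: q01.
    rewrite urho mxE (le_trans (ler_normD _ _))// lerD//.
      by rewrite (le_trans (vnorm_ge _ j))// uq.
    by rewrite (bigD1 j)//= lerDl sumr_ge0.
  - by apply: sublinear_sum => j; exact: (sublinear_norm _).1 (srho j).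
by move=> j; apply: sublinear_le su => k; exact: vnorm_ge.
Qed.

(** [x k] is the increment of the deviation plus the constant [c]. *)
Lemma vsublinear_incr {n} (x : nat -> 'rV[R]_n) (c : 'rV[R]_n) :
  vsublinear (fun k => \sum_(i < k) x i - k%:R *: c) -> vsublinear x.
Proof.
move=> sx; have -> : x = fun k =>
    (\sum_(i < k + 1) x i - (k + 1)%:R *: c) + (c - (\sum_(i < k) x i - k%:R *: c)).
  apply/funext => k; rewrite addn1 big_ord_recr/= -natr1 scalerDl scale1r.
  by apply/rowP => j; rewrite !mxE; ring.
apply: vsublinearD; first exact: (vsublinear_shift 1 _ sx).
by apply: vsublinearD; [exact: vsublinear_cst|exact: vsublinearN].
Qed.

(* E is the limit of the powers of B; the hypothesis on B ^+ m is Doeblin's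
   minorization, which makes B ^+ m a strict contraction on the kernel of E. *)
Lemma linear_growth_primitive {n} (B E : 'M[R]_n) (m : nat) (d : R)
  (lam x : nat -> 'rV[R]_n) (c : 'rV[R]_n) :
  B *m E = E -> E *m B = E -> E *m E = E -> (forall j, \sum_i B i j = 1) ->
  (forall j, \sum_i E i j = 1) -> (0 < m)%N -> 0 < d <= 1 ->
  (forall i j, 0 <= E i j) -> (forall i j, d * E i j <= (B ^+ m) i j) ->
  (forall k, lam k.+1 = (lam k + x k) *m B) ->
  vsublinear (fun k => \sum_(i < k) x i - k%:R *: c) ->
  vsublinear (fun k => lam k - k%:R *: (c *m E)).
Proof.
move=> BE EB EE B1 E1 m0 /andP[d0 d1] E0 dE lamS sx.
have s := vsublinear_incr _ _ sx.
pose v k := lam k - lam k *m E.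
(* Since [B *m E = E], the [E]-component merely accumulates the inputs; only [v], in the kernel of
   [E], needs contraction. *)
have lamE k : lam k *m E = lam 0%N *m E + (\sum_(i < k) x i) *m E.
  elim: k => [|k IH]; first by rewrite big_ord0 mul0mx addr0.
  by rewrite lamS -mulmxA BE mulmxDl IH big_ord_recr/= mulmxDl addrA.
have vE k : v k *m E = 0 by rewrite /v mulmxBl -mulmxA EE subrr.
have Bm1 j : \sum_i (B ^+ m) i j = 1.
  elim: {m0 dE} m j => [|m IH] j.
    rewrite expr0 (bigD1 j)//= mxE eqxx big1 ?addr0// => i ij.
    by rewrite mxE (negbTE ij).
  rewrite exprSr; under eq_bigr do rewrite mxE.
  by rewrite exchange_big/= -[RHS](B1 j); apply: eq_bigr => i _; rewrite -mulr_suml IH mul1r.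
have sv : vsublinear v.
  apply: (@vsublinear_contraction _ B v (fun k => x k *m (B - E)) m (1 - d)) => //.
  - by rewrite subr_ge0 d1 ltrBlDr ltrDl.
  - move=> k; rewrite /v lamS -mulmxA BE mulmxBl -mulmxA EB -mulmxBr mulmxDl.
    by rewrite mulmxDl mulmxBr [in RHS]mulmxBr; apply/rowP => j; rewrite !mxE; ring.
  - exact: vsublinear_mulmx.
  (* As [v k *m E = 0], subtracting [d *: E] is free and leaves a nonnegative matrix with column
     sums [1 - d]. *)
  - move=> k; have -> : v k *m B ^+ m = v k *m (B ^+ m - d *: E).
      by rewrite mulmxBr -scalemxAr vE scaler0 subr0.
    apply: vnorm_le => [|j]; first by rewrite mulr_ge0 ?vnorm_ge0 ?subr_ge0.
    rewrite mxE (le_trans (ler_norm_sum _ _ _))//.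
    apply: (@le_trans _ _ (\sum_i vnorm (v k) * (B ^+ m - d *: E) i j)).
      apply: ler_sum => i _; rewrite normrM.
      have M0 : 0 <= (B ^+ m - d *: E) i j by rewrite !mxE subr_ge0.
      by rewrite (ger0_norm M0) ler_wpM2r// vnorm_ge.
    rewrite -mulr_sumr mulrC ler_wpM2r ?vnorm_ge0//.
    under eq_bigr do rewrite !mxE.
    by rewrite sumrB Bm1 -mulr_sumr E1 mulr1.
have -> : (fun k => lam k - k%:R *: (c *m E)) =
    (fun k => v k + (lam 0%N *m E + (\sum_(i < k) x i - k%:R *: c) *m E)).
  apply/funext => k; rewrite /v lamE mulmxBl scalemxAl.
  by apply/rowP => j; rewrite !mxE; ring.
apply: vsublinearD => //; apply: vsublinearD; first exact: vsublinear_cst.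
exact: vsublinear_mulmx.
Qed.

(** The rate [z] solves [z = z *m Q + c' *m W]. Subtracting [k%:R *: z] therefore leaves a recursion
    by [Q] whose input is sublinear. *)
Lemma linear_growth_substochastic {n p} (Q : 'M[R]_n) (W : 'M[R]_(p, n)) (m : nat) (q : R)
  (lam x : nat -> 'rV[R]_n) (c : 'rV[R]_n) (y : nat -> 'rV[R]_p) (c' : 'rV[R]_p) :
  (forall i j, 0 <= Q i j) -> (0 < m)%N -> 0 <= q < 1 ->
  (forall j, \sum_i (Q ^+ m) i j <= q) -> 1%:M - Q \in unitmx ->
  (forall k, lam k.+1 = (lam k + x k) *m Q + y k *m W) ->
  vsublinear (fun k => \sum_(i < k) x i - k%:R *: c) ->
  vsublinear (fun k => y k - k%:R *: c') ->
  vsublinear (fun k => lam k - k%:R *: (c' *m W *m invmx (1%:M - Q))).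
Proof.
move=> Q0 m0 q01 Qq Qu lamS sx sy.
have s := vsublinear_incr _ _ sx.
set z := c' *m W *m _.
have zE : z = z *m Q + c' *m W.
  by rewrite -[X in _ + X](mulmxKV Qu) -/z mulmxBr mulmx1 addrC subrK.
have Qm0 i j : 0 <= (Q ^+ m) i j.
  elim: {m0 Qq} m i j => [|m IH] i j; first by rewrite expr0 mxE ler0n.
  by rewrite exprSr mxE sumr_ge0// => k _; rewrite mulr_ge0.
apply: (@vsublinear_contraction _ Q _
  (fun k => (y k - k%:R *: c') *m W + (x k *m Q + (- z))) m q) => //.
- move=> k; rewrite lamS -natr1 scalerDl scale1r {1}zE scalerDr scalemxAl.
  rewrite !mulmxDl !mulNmx -!scalemxAl.
  by apply/rowP => j; rewrite !mxE; ring.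
- apply: vsublinearD; first exact: vsublinear_mulmx.
  by apply: vsublinearD; [exact: vsublinear_mulmx|exact: vsublinear_cst].
- move=> k; set v := _ - _; apply: vnorm_le => [|j].
    by rewrite mulr_ge0 ?vnorm_ge0//; case/andP: q01.
  rewrite mxE (le_trans (ler_norm_sum _ _ _))//.
  apply: (@le_trans _ _ (\sum_i vnorm v * (Q ^+ m) i j)).
    by apply: ler_sum => i _; rewrite normrM (ger0_norm (Qm0 i j)) ler_wpM2r// vnorm_ge.
  by rewrite -mulr_sumr mulrC ler_wpM2r ?vnorm_ge0.
Qed.
End vsublinear.

(** * Weakly connected networks *)

Section nonneg_powers.
Context {R : realType} {n : nat} (M : 'M[R]_n).
Hypothesis M0 : forall i j, 0 <= M i j.

Lemma mxpow_ge0 a i j : 0 <= (M ^+ a) i j.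
Proof.
elim: a i j => [|a IH] i j; first by rewrite expr0 mxE ler0n.
by rewrite exprSr mxE sumr_ge0// => k _; rewrite mulr_ge0.
Qed.

Lemma mxpow_gt0D a b i j k :
  0 < (M ^+ a) i j -> 0 < (M ^+ b) j k -> 0 < (M ^+ (a + b)) i k.
Proof.
move=> Ma Mb; rewrite exprD mxE (bigD1 j)//= ltr_wpDr ?mulr_gt0//.
by rewrite sumr_ge0// => l _; rewrite mulr_ge0 ?mxpow_ge0.
Qed.

Lemma path_within_mxpow {m} (c : 'I_n -> 'I_m) (s : 'I_m) i j :
  path_within M c s i j -> exists a, 0 < (M ^+ a) i j.
Proof.
move=> /connectP[p + ->]; elim: p i => [|k p IH] i /=.
  by move=> _; exists 0%N; rewrite expr0 mxE eqxx.
move=> /andP[/and3P[_ _ Mik] /IH[a Ha]]; exists (1 + a)%N.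
by apply: mxpow_gt0D Ha; rewrite expr1.
Qed.

Lemma mxpow_loop_gt0 a i : 0 < M i i -> 0 < (M ^+ a) i i.
Proof.
move=> Mii; elim: a => [|a IH]; first by rewrite expr0 mxE eqxx.
by rewrite -addn1; apply: mxpow_gt0D IH _; rewrite expr1.
Qed.

(* Strong connectivity plus one self-loop per class makes the powers of M
   eventually positive inside every class. *)
Lemma primitive_classes {m} (c : 'I_n -> 'I_m) :
  (forall s i j, c i = s -> c j = s -> path_within M c s i j) ->
  (forall s, exists i, c i = s /\ 0 < M i i) ->
  exists2 a, (0 < a)%N & forall i j, c i = c j -> 0 < (M ^+ a) i j.
Proof.
move=> conn aper.
have ev i j : \forall a \near \oo, c i = c j -> 0 < (M ^+ a) i j.
  have [cij|ncij] := eqVneq (c i) (c j); last first.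
    by apply: nearW => a cij; rewrite cij eqxx in ncij.
  have [l [cl Mll]] := aper (c i).
  have [a Ha] := path_within_mxpow _ _ _ _ (conn (c i) i l erefl cl).
  have [b Hb] := path_within_mxpow _ _ _ _ (conn (c i) l j cl (esym cij)).
  exists (a + b)%N => // e /= abe _.
  (* Go from [i] to [l] in [a] steps, wait at the self-loop of [l], then reach [j] in [b] steps. *)
  have -> : e = (a + ((e - (a + b)) + b))%N by lia.
  apply: mxpow_gt0D Ha _; apply: mxpow_gt0D Hb.
  exact: mxpow_loop_gt0.
have [N _ HN] : \forall a \near \oo, forall ij : 'I_n * 'I_n,
    c ij.1 = c ij.2 -> 0 < (M ^+ a) ij.1 ij.2.
  by apply: filter_forall => -[i j]; exact: ev.
by exists N.+1 => // i j; exact: (HN N.+1 (leqnSn N) (i, j)).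
Qed.

Hypothesis M1 : forall j, \sum_i M i j <= 1.

Let colsum a j := \sum_i (M ^+ a) i j.

Let colsumD a b j : colsum (a + b) j = \sum_k colsum a k * (M ^+ b) k j.
Proof.
rewrite /colsum exprD; under eq_bigr do rewrite mxE.
by rewrite exchange_big/=; apply: eq_bigr => k _; rewrite mulr_suml.
Qed.

Let colsum_le1 a j : colsum a j <= 1.
Proof.
elim: a j => [|a IH] j.
  rewrite /colsum expr0 (bigD1 j)//= mxE eqxx big1 ?addr0// => i ij.
  by rewrite mxE (negbTE ij).
rewrite -addn1 colsumD (le_trans _ (M1 j))//; apply: ler_sum => k _.
by rewrite expr1 ler_piMl.
Qed.

Let colsum_lt1S a b j : colsum a j < 1 -> (a <= b)%N -> colsum b j < 1.
Proof.
move=> aj ab; rewrite -(subnK ab) colsumD (le_lt_trans _ aj)//.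
by apply: ler_sum => k _; rewrite ler_piMl ?mxpow_ge0.
Qed.

Let colsum_edge a i j : colsum a i < 1 -> 0 < M i j -> colsum a.+1 j < 1.
Proof.
move=> ai Mij; rewrite -addn1 colsumD expr1 (lt_le_trans _ (M1 j))//.
rewrite (bigD1 i)//= [X in _ < X](bigD1 i)//=.
apply: ltr_leD; first by rewrite -[ltRHS]mul1r ltr_pM2r.
by apply: ler_sum => k _; rewrite ler_piMl.
Qed.

(** A column sum below 1 stays below 1 in higher powers and passes along links, so each class
    spreads the deficit of its leaking column to all of its members. The maximum over finitely many
    columns is [q]. *)
Lemma substochastic_contraction {m} (c : 'I_n -> 'I_m) :
  (forall s i j, c i = s -> c j = s -> path_within M c s i j) ->
  (forall s, exists2 i, c i = s & \sum_k M k i < 1) ->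
  exists a q, [/\ (0 < a)%N, 0 <= q < 1 & forall j, \sum_i (M ^+ a) i j <= q].
Proof.
move=> conn leak.
have ev j : \forall a \near \oo, colsum a j < 1.
  have [i ci Mi] := leak (c j).
  have /connectP[p + ->] := conn _ i j ci erefl.
  have [a Ha] : exists a, colsum a i < 1 by exists 1%N; rewrite /colsum expr1.
  elim: p i a Ha {ci Mi} => [|k p IH] i a Ha /=.
    by move=> _; exists a => // b /=; exact: colsum_lt1S.
  by move=> /andP[/and3P[_ _ Mik]]; apply: IH; exact: colsum_edge Ha Mik.
have [N _ HN] : \forall a \near \oo, forall j, colsum a j < 1.
  exact: filter_forall.
exists N.+1, (\big[Num.max/0]_j colsum N.+1 j); split => //.
  rewrite bigmax_ge_id/=; apply: bigmax_lt => // j _.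
  exact: (HN N.+1 (leqnSn N)).
by move=> j; exact: (le_bigmax _ (fun j => colsum N.+1 j)).
Qed.

(** A row vector killed by [1%:M - M] is fixed by [M], hence by [M ^+ a], which shrinks its sup norm
    by [q < 1]; so it is zero. *)
Lemma substochastic_unitmx a (q : R) : 0 <= q < 1 ->
  (forall j, \sum_i (M ^+ a) i j <= q) -> 1%:M - M \in unitmx.
Proof.
move=> /andP[q0 q1] Mq; rewrite -row_free_unit -kermx_eq0.
apply/eqP/row_matrixP => r; rewrite row0.
set v := row r _.
have vM : v = v *m M.
  apply/eqP; rewrite -subr_eq0 -{1}[v]mulmx1 -mulmxBr.
  by rewrite /v -row_mul mulmx_ker row0.
have vMa : v = v *m M ^+ a.
  elim: {Mq} a => [|a IH]; first by rewrite expr0 mulmx1.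
  by rewrite exprSr -mulmxE mulmxA -IH.
have vq : vnorm v <= q * vnorm v.
  rewrite {1}vMa; apply: vnorm_le => [|j]; first by rewrite mulr_ge0 ?vnorm_ge0.
  rewrite mxE (le_trans (ler_norm_sum _ _ _))//.
  apply: (@le_trans _ _ (\sum_i vnorm v * (M ^+ a) i j)).
    apply: ler_sum => i _; rewrite normrM (ger0_norm (mxpow_ge0 _ _ _)).
    by rewrite ler_wpM2r ?mxpow_ge0// vnorm_ge.
  by rewrite -mulr_sumr mulrC ler_wpM2r ?vnorm_ge0.
have v0 : vnorm v <= 0 by have := vnorm_ge0 v; nra.
apply/rowP => j; rewrite [RHS]mxE; apply/eqP; rewrite -normr_le0.
exact: le_trans (vnorm_ge v j) v0.
Qed.
End nonneg_powers.

(** * Growth rates on a weak graph *)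

Section weak_graph.
Context {R : realType} {NS NR S Rn : nat}.
Variables (A : 'M[R]_(NS + NR)) (cS : 'I_NS -> 'I_S) (cR : 'I_NR -> 'I_Rn)
  (p : 'I_NS -> R).
Hypotheses (HA0 : forall l k, 0 <= A l k)
  (HAstoch : forall k, \sum_(l < NS + NR) A l k = 1)
  (HS : (0 < S)%N)
  (HAblock : dlsubmx A = 0)
  (HAdiag : forall l k : 'I_NS, ulsubmx A l k != 0 -> cS l = cS k)
  (HSconn : forall (s : 'I_S) (l k : 'I_NS), cS l = s -> cS k = s ->
              path_within (ulsubmx A) cS s l k)
  (HSaper : forall s : 'I_S, exists l : 'I_NS, cS l = s /\ 0 < ulsubmx A l l)
  (HpA : forall l : 'I_NS, \sum_(k < NS) ulsubmx A l k * p k = p l)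
  (Hppos : forall l, 0 < p l)
  (Hpsum : forall s : 'I_S, \sum_(l < NS | cS l == s) p l = 1)
  (HRconn : forall (r : 'I_Rn) (l k : 'I_NR), cR l = r -> cR k = r ->
              path_within (drsubmx A) cR r l k)
  (HRS : forall (r : 'I_Rn) (s : 'I_S), exists (l : 'I_NS) (k : 'I_NR),
              [/\ cS l = s, cR k = r & 0 < ursubmx A l k]).

Let B := ulsubmx A.
Let Q := drsubmx A.
Let E := Emx cS p.

Let B0 i j : 0 <= B i j. Proof. by rewrite !mxE. Qed.
Let Q0 i j : 0 <= Q i j. Proof. by rewrite !mxE. Qed.

Let B1 j : \sum_i B i j = 1.
Proof.
rewrite -(HAstoch (lshift NR j)) big_split_ord/= [X in _ + X]big1 ?addr0.
  by apply: eq_bigr => i _; rewrite !mxE.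
move=> i _; have := congr1 (fun M : 'M[R]_(NR, NS) => M i j) HAblock.
by rewrite !mxE.
Qed.

Let E1 j : \sum_i E i j = 1.
Proof.
rewrite -(Hpsum (cS j)) [RHS]big_mkcond; apply: eq_bigr => i _.
by rewrite mxE.
Qed.

Let EmxE i j : E i j = if cS i == cS j then p i else 0.
Proof. by rewrite mxE. Qed.

Let BE : B *m E = E.
Proof.
apply/matrixP => i j; rewrite [LHS]mxE EmxE; case: eqVneq => [ij|nij].
  rewrite -(HpA i); apply: eq_bigr => k _; rewrite EmxE.
  have [->|Bik] := eqVneq (B i k) 0; first by rewrite !mul0r.
  by rewrite -(HAdiag _ _ Bik) ij eqxx.
apply: big1 => k _; rewrite EmxE.
have [->|Bik] := eqVneq (B i k) 0; first by rewrite mul0r.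
by rewrite -(HAdiag _ _ Bik) (negbTE nij) mulr0.
Qed.

Let EB : E *m B = E.
Proof.
apply/matrixP => i j; rewrite [LHS]mxE EmxE; case: eqVneq => [ij|nij].
  rewrite -[RHS]mulr1 -(B1 j) mulr_sumr; apply: eq_bigr => k _; rewrite EmxE.
  have [->|Bkj] := eqVneq (B k j) 0; first by rewrite !mulr0.
  by rewrite (HAdiag _ _ Bkj) ij eqxx.
apply: big1 => k _; rewrite EmxE.
have [->|Bkj] := eqVneq (B k j) 0; first by rewrite mulr0.
by rewrite (HAdiag _ _ Bkj) (negbTE nij) mul0r.
Qed.

Let EE : E *m E = E.
Proof.
apply/matrixP => i j; rewrite [LHS]mxE EmxE; case: eqVneq => [ij|nij].
  rewrite -[RHS]mulr1 -(Hpsum (cS j)) mulr_sumr [RHS]big_mkcond.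
  apply: eq_bigr => k _; rewrite !EmxE ij (eq_sym (cS j)).
  by case: eqVneq => // _; rewrite mulr0.
apply: big1 => k _; rewrite !EmxE.
have [ik|_] := eqVneq (cS i) (cS k); last by rewrite mul0r.
by rewrite -ik (negbTE nij) mulr0.
Qed.

Let minorization : exists m d, [/\ (0 < m)%N, 0 < d <= 1 &
  forall i j, d * E i j <= (B ^+ m) i j].
Proof.
have [m m0 Bm] := primitive_classes _ B0 cS HSconn HSaper.
(* The least entry of [B ^+ m] inside the classes will be [d]; pairs across classes get the neutral
   value 1, since [E] vanishes there. *)
pose F (ij : 'I_NS * 'I_NS) : R := if cS ij.1 == cS ij.2 then (B ^+ m) ij.1 ij.2 else 1.
exists m, (\big[Num.min/1]_ij F ij); split => //.
  rewrite bigmin_le_id andbT; apply: lt_bigmin => // -[i j] _.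
  by rewrite /F; case: eqP => // /Bm.
move=> i j; rewrite mxE; case: eqP => ij; last by rewrite mulr0 mxpow_ge0.
have dF : \big[Num.min/1]_ij F ij <= F (i, j) by exact: bigmin_le.
apply: (@le_trans _ _ (F (i, j))); last by rewrite /F/= ij eqxx.
apply: le_trans dF; rewrite ler_piMr//.
  apply: le_bigmin => // -[k l] _; rewrite /F; case: ifP => // _.
  exact: mxpow_ge0.
rewrite -(Hpsum (cS i)) (bigD1 i)//= lerDl sumr_ge0// => k _.
exact: ltW.
Qed.

Let Qle1 j : \sum_i Q i j <= 1.
Proof.
rewrite -(HAstoch (rshift NS j)) big_split_ord/=.
rewrite [X in _ <= _ + X](eq_bigr (fun i => Q i j)); last by move=> i _; rewrite !mxE.
by rewrite lerDr sumr_ge0.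
Qed.

(** A full column of [A] sums to 1, so a positive weight from a sending agent leaves less than 1 for
    the receiving block. The sending sub-network labelled 0 supplies it. *)
Let leak r : exists2 k, cR k = r & \sum_i Q i k < 1.
Proof.
have [l [k [_ ck Alk]]] := HRS r (Ordinal HS).
exists k => //; rewrite -(HAstoch (rshift NS k)) big_split_ord/=.
rewrite [X in _ < _ + X](eq_bigr (fun i => Q i k)); last by move=> i _; rewrite !mxE.
rewrite ltrDr (bigD1 l)//= ltr_wpDr ?sumr_ge0//.
by rewrite !mxE in Alk.
Qed.

(** [A] is block triangular: sending coordinates evolve by [B] alone with rate [lsubmx c *m E], then
    drive the receiving ones through [ursubmx A]. *)
Lemma receiving_growth (lam x : nat -> 'rV[R]_(NS + NR)) (c : 'rV[R]_(NS + NR)) :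
  (forall i, lam i.+1 = (lam i + x i) *m A) ->
  vsublinear (fun i => \sum_(j < i) x j - i%:R *: c) ->
  vsublinear (fun i => rsubmx (lam i) - i%:R *: (lsubmx c *m Omx A cS p)).
Proof.
move=> lamS sx.
have lamA i : lam i.+1 = row_mx ((lsubmx (lam i) + lsubmx (x i)) *m B)
    ((rsubmx (lam i) + rsubmx (x i)) *m Q
     + (lsubmx (lam i) + lsubmx (x i)) *m ursubmx A).
  rewrite lamS -{1}[A]submxK -[lam i + x i]hsubmxK mul_row_block HAblock mulmx0 addr0.
  by rewrite !linearD/= [in LHS](addrC (_ *m ursubmx A)).
have sl : vsublinear (fun i => \sum_(j < i) lsubmx (x j) - i%:R *: lsubmx c).
  move=> j; rewrite (_ : (fun k => _) = (fun k =>
      (\sum_(i < k) x i - k%:R *: c) 0 (lshift NR j))); first exact: sx.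
  by apply/funext => k; rewrite !mxE !summxE; congr (_ - _); apply: eq_bigr => i _; rewrite mxE.
have sr : vsublinear (fun i => \sum_(j < i) rsubmx (x j) - i%:R *: rsubmx c).
  move=> j; rewrite (_ : (fun k => _) = (fun k =>
      (\sum_(i < k) x i - k%:R *: c) 0 (rshift NS j))); first exact: sx.
  by apply/funext => k; rewrite !mxE !summxE; congr (_ - _); apply: eq_bigr => i _; rewrite mxE.
have [m [d [m0 d01 dE]]] := minorization.
have sS : vsublinear (fun i => lsubmx (lam i) - i%:R *: (lsubmx c *m E)).
  apply: (linear_growth_primitive B E m d _ (fun i => lsubmx (x i))) => //.
  - by move=> i j; rewrite mxE; case: ifP => // _; exact: ltW.
  - by move=> k; rewrite lamA row_mxKl.
have [a [q [a0 q01 Qq]]] := substochastic_contraction _ Q0 Qle1 cR HRconn leak.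
have Qu := substochastic_unitmx _ Q0 a q q01 Qq.
rewrite /Omx !mulmxA.
apply: (linear_growth_substochastic Q (ursubmx A) a q _ (fun i => rsubmx (x i))
  (rsubmx c) (fun i => lsubmx (lam i) + lsubmx (x i))) => //.
- by move=> k; rewrite lamA row_mxKr.
- rewrite (_ : (fun k => _) = (fun k =>
    (lsubmx (lam k) - k%:R *: (lsubmx c *m E)) + lsubmx (x k))); last first.
    by apply/funext => k; rewrite addrAC.
  by apply: vsublinearD => //; exact: vsublinear_incr sl.
Qed.
End weak_graph.

(** * Beliefs *)

Lemma cvg_sumr {R : realType} (I : Type) (r : seq I) (u : I -> nat -> R) (l : I -> R) :
  (forall i, u i n @[n --> \oo] --> l i) ->
  \sum_(i <- r) u i n @[n --> \oo] --> \sum_(i <- r) l i.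
Proof. by move=> ul; apply: cvg_big => // ; exact: add_continuous. Qed.

Section posterior.
Context {R : realType} {H : nat}.

(** Each ratio [b i th / b i ts] is eventually below [expR (a th / 2) ^+ i]. The ratios sum to the
    reciprocal of [b i ts], which thus tends to 1; then [ln (b i ts)] vanishes in the limit and the
    ratio's rate is that of [b i th]. *)
Lemma posterior_concentration (b : nat -> 'I_H -> R) (ts : 'I_H) (a : 'I_H -> R) :
  (forall i th, 0 < b i th) -> (forall i, \sum_th b i th = 1) ->
  (forall th, th != ts -> a th < 0) ->
  (forall th, th != ts -> (ln (b i th) - ln (b i ts)) / i%:R @[i --> \oo] --> a th) ->
  b i ts @[i --> \oo] --> (1 : R) /\
  forall th, th != ts -> ln (b i th) / i%:R @[i --> \oo] --> a th.
Proof.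
move=> b0 b1 a0 ba.
have ratio th : th != ts -> b i th / b i ts @[i --> \oo] --> (0 : R).
  move=> tn; have ath := a0 _ tn.
  have z1 : `|expR (a th / 2)| < 1.
    by rewrite ger0_norm ?expR_ge0// expR_lt1 pmulr_llt0.
  suff sq : \forall i \near \oo, (0 : R) <= b i th / b i ts <= expR (a th / 2) ^+ i.
    by apply: (squeeze_cvgr sq); [exact: cvg_cst|exact: cvg_expr].
  have e0 : 0 < - (a th / 2) by rewrite oppr_gt0 pmulr_llt0.
  have /cvgrPdist_lt/(_ _ e0) := ba th tn; move=> [N _ HN].
  exists N.+1 => // i /= Ni; rewrite divr_ge0 ?(ltW (b0 _ _))//=.
  have i0 : (0 : R) < i%:R by rewrite ltr0n; lia.
  rewrite -expRM_natr -[b i th / _]lnK ?posrE ?divr_gt0// ler_expR ln_div ?posrE//.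
  rewrite -ler_pdivrMr//; have := HN i (ltnW Ni); rewrite /= ltr_distlC => /andP[_ /ltW].
  by have -> : a th + - (a th / 2) = a th / 2 by field.
have bts : b i ts @[i --> \oo] --> (1 : R).
  have inv : (fun i => \sum_th b i th / b i ts) @ \oo -->
      \sum_(th < H) (if th == ts then 1 else 0 : R).
    apply: cvg_sumr => th; case: eqVneq => [->|]; last exact: ratio.
    rewrite (_ : (fun i => _) = cst 1); first exact: cvg_cst.
    by apply/funext => i; rewrite divff// gt_eqF.
  rewrite -big_mkcond big_pred1_eq in inv.
  have := cvgV (oner_neq0 R) inv; rewrite invr1 => invV.
  rewrite (_ : (fun i => b i ts) = (fun i => (\sum_th b i th / b i ts)^-1)); first exact: invV.
  apply/funext => i /=.
  by rewrite -mulr_suml b1 mul1r invrK.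
split=> // th tn.
have lnts : ln (b i ts) / i%:R @[i --> \oo] --> (0 : R).
  have l0 : ln (b i ts) @[i --> \oo] --> (0 : R).
    by rewrite -(@ln1 R); apply: continuous_cvg => //; exact: continuous_ln.
  have i0 : (i%:R^-1 : R) @[i --> \oo] --> (0 : R).
    by rewrite -(cvg_shiftS (fun n => (n%:R^-1 : R))); exact: cvg_harmonic.
  have H0 := cvgM l0 i0; rewrite mulr0 in H0; exact: H0.
have := cvgD (ba th tn) lnts; rewrite addr0 => lim.
rewrite (_ : (fun i => _) = (fun i => (ln (b i th) - ln (b i ts)) / i%:R)
  \+ (fun i => ln (b i ts) / i%:R)); first exact: lim.
by apply/funext => i /=; rewrite -mulrDl subrK.
Qed.
End posterior.

Section beliefs.
Context {R : realType} {N H : nat}.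
Variables (mu0 : 'I_N -> 'I_H -> R) (A : 'M[R]_N) (lik : nat -> 'I_N -> 'I_H -> R).
Hypotheses (mu0_gt0 : forall k th, 0 < mu0 k th)
  (mu0_sum : forall k, \sum_(th < H) mu0 k th = 1)
  (lik_gt0 : forall i k th, 0 < lik i k th).

Let sum_gt0 (u : 'I_H -> R) (th0 : 'I_H) : (forall th, 0 < u th) -> 0 < \sum_th u th.
Proof.
move=> u0; rewrite (bigD1 th0)//= ltr_pwDl// sumr_ge0// => th _; exact: ltW.
Qed.

Let bayes_gt0 (u v : 'I_H -> R) th : (forall th, 0 < u th) -> (forall th, 0 < v th) ->
  0 < bayes_update u v th.
Proof.
move=> u0 v0; rewrite /bayes_update divr_gt0 ?mulr_gt0//.
by apply: (sum_gt0 _ th) => th'; rewrite mulr_gt0.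
Qed.

Let prod_gt0 (psi : 'I_N -> 'I_H -> R) k th : (forall l th, 0 < psi l th) ->
  0 < \prod_(l < N) powR (psi l th) (A l k).
Proof. by move=> psi0; apply: prodr_gt0 => l _; exact: powR_gt0. Qed.

Lemma beliefs_gt0 i k th : 0 < beliefs mu0 A lik i k th.
Proof.
elim: i k th => [|i IH] k th //=.
have psi0 l th' : 0 < bayes_update (beliefs mu0 A lik i l) (lik i l) th'.
  exact: bayes_gt0.
rewrite /combine; apply: divr_gt0; first exact: (prod_gt0 _ k th psi0).
by apply: (sum_gt0 _ th) => th'; exact: (prod_gt0 _ k th' psi0).
Qed.

(** The witness [th0] makes the set of hypotheses nonempty, so that the normalising sum is
    positive. *)
Lemma beliefs_sum (th0 : 'I_H) i k : \sum_th beliefs mu0 A lik i k th = 1.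
Proof.
case: i => [//|i] /=.
rewrite /combine -mulr_suml divff// gt_eqF//.
apply: (sum_gt0 _ th0) => th; apply: (prod_gt0 (fun l =>
  bayes_update (beliefs mu0 A lik i l) (lik i l))) => l th'.
by apply: bayes_gt0 => // th''; exact: beliefs_gt0.
Qed.

Lemma ln_prodr (I : Type) (r : seq I) (u : I -> R) : (forall i, 0 < u i) ->
  ln (\prod_(i <- r) u i) = \sum_(i <- r) ln (u i).
Proof.
move=> u0; elim: r => [|i r IH]; first by rewrite !big_nil ln1.
by rewrite !big_cons lnM ?posrE ?prodr_gt0// IH.
Qed.

(** The normalising constants of both the Bayes step and the combination do not depend on the
    hypothesis, so they cancel in the ratio. *)
Lemma log_ratio_beliefs i k th ts :
  ln (beliefs mu0 A lik i.+1 k th) - ln (beliefs mu0 A lik i.+1 k ts) =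
  \sum_l (ln (beliefs mu0 A lik i l th) - ln (beliefs mu0 A lik i l ts)
          + (ln (lik i l th) - ln (lik i l ts))) * A l k.
Proof.
have b0 := beliefs_gt0 i.
have psi0 l th' : 0 < bayes_update (beliefs mu0 A lik i l) (lik i l) th'.
  exact: bayes_gt0.
have lnc th' : ln (beliefs mu0 A lik i.+1 k th') =
    \sum_l A l k * ln (bayes_update (beliefs mu0 A lik i l) (lik i l) th')
    - ln (\sum_(th' < H) \prod_(l < N)
        powR (bayes_update (beliefs mu0 A lik i l) (lik i l) th') (A l k)).
  rewrite /= /combine ln_div ?posrE; first last.
  - by apply: (sum_gt0 _ th') => th''; exact: (prod_gt0 _ k th'' psi0).
  - exact: (prod_gt0 _ k th' psi0).
  rewrite ln_prodr; last by move=> l; exact: powR_gt0.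
  by congr (_ - _); apply: eq_bigr => l _; rewrite ln_powR.
rewrite !lnc opprB addrA subrK -sumrB; apply: eq_bigr => l _.
rewrite /bayes_update !ln_div ?posrE ?mulr_gt0//; last 2 first.
- by apply: (sum_gt0 _ th) => th'; rewrite mulr_gt0.
- by apply: (sum_gt0 _ th) => th'; rewrite mulr_gt0.
by rewrite !lnM ?posrE//; ring.
Qed.
End beliefs.

Theorem theorem1
  (R : realType) (dO : measure_display) (Omega : measurableType dO)
  (P : probability Omega R)
  (NS NR S Rn H : nat)
  (A : 'M[R]_(NS + NR))
  (cS : 'I_NS -> 'I_S) (cR : 'I_NR -> 'I_Rn) (p : 'I_NS -> R)
  (dX : 'I_(NS + NR) -> measure_display) (X : forall k, measurableType (dX k))
  (nu : forall k, {measure set (X k) -> \bar R})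
  (f : forall k, X k -> R) (L : forall k, X k -> 'I_H -> R)
  (xi : forall k, nat -> Omega -> X k)
  (mu0 : 'I_(NS + NR) -> 'I_H -> R)
  (* combination matrix: nonnegative, left-stochastic *)
  (HA0 : forall l k, 0 <= A l k)
  (HAstoch : forall k, \sum_(l < NS + NR) A l k = 1)
  (* weak graph: S >= 1 sending sub-networks (labels cS, listed in increasing
     order, all nonempty), Rn receiving sub-networks (labels cR, likewise) *)
  (HS : (0 < S)%N)
  (HcSmono : forall l l' : 'I_NS, (l <= l')%N -> (cS l <= cS l')%N)
  (HcSsurj : forall s : 'I_S, exists l, cS l = s)
  (HcRmono : forall k k' : 'I_NR, (k <= k')%N -> (cR k <= cR k')%N)
  (HcRsurj : forall r : 'I_Rn, exists k, cR k = r)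
  (* no links from receiving to sending agents *)
  (HAblock : dlsubmx A = 0)
  (* no links between distinct sending sub-networks *)
  (HAdiag : forall l k : 'I_NS, ulsubmx A l k != 0 -> cS l = cS k)
  (* each sending sub-network is strongly connected *)
  (HSconn : forall (s : 'I_S) (l k : 'I_NS), cS l = s -> cS k = s ->
              path_within (ulsubmx A) cS s l k)
  (HSaper : forall s : 'I_S, exists l : 'I_NS, cS l = s /\ 0 < ulsubmx A l l)
  (* Perron vectors p^(s) of the sending sub-networks, stacked in p *)
  (HpA : forall l : 'I_NS, \sum_(k < NS) ulsubmx A l k * p k = p l)
  (Hppos : forall l, 0 < p l)
  (Hpsum : forall s : 'I_S, \sum_(l < NS | cS l == s) p l = 1)
  (* each receiving sub-network is connected ... *)
  (HRconn : forall (r : 'I_Rn) (l k : 'I_NR), cR l = r -> cR k = r ->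
              path_within (drsubmx A) cR r l k)
  (* ... and connected to at least one agent of each sending sub-network *)
  (HRS : forall (r : 'I_Rn) (s : 'I_S), exists (l : 'I_NS) (k : 'I_NR),
              [/\ cS l = s, cR k = r & 0 < ursubmx A l k])
  (* data: xi k i is the observation of agent k at time i+1 *)
  (Hxi_meas : forall k i, measurable_fun setT (xi k i))
  (Hxi_indep : forall k, mutually_independent P (xi k))
  (* true densities / pmfs f_k w.r.t. the reference measure nu_k *)
  (Hf0 : forall k x, 0 <= f k x)
  (Hf_meas : forall k, measurable_fun setT (f k))
  (Hxi_law : forall k i (B : set (X k)), measurable B ->
      P (xi k i @^-1` B) = (\int[nu k]_(x in B) (f k x)%:E)%E)
  (* likelihoods: densities / pmfs w.r.t. nu_k *)
  (HL0 : forall k x th, 0 <= L k x th)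
  (HL_meas : forall k th, measurable_fun setT (fun x => L k x th))
  (HL1 : forall k th, (\int[nu k]_x (L k x th)%:E)%E = 1%E)
  (* initial beliefs are probability mass functions on Theta *)
  (Hmu0sum : forall k, \sum_(th < H) mu0 k th = 1)
  (* (i) finite KL divergences *)
  (Hkl : forall k th, KL (nu k) (f k) (fun x => L k x th) \is a fin_num)
  (* (ii) positive initial beliefs *)
  (Hmu0pos : forall k th, 0 < mu0 k th)
  (* (iii) unique minimizer of D_k for every receiving agent *)
  (Huniq : forall k : 'I_NR, exists ts : 'I_H, forall th, th != ts ->
      Dagg A cS p nu f L k ts < Dagg A cS p nu f L k th) :
  forall (k : 'I_NR) (ts : 'I_H),
    (forall th, th != ts -> Dagg A cS p nu f L k ts < Dagg A cS p nu f L k th) ->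
    {ae P, forall w, (fun i => beliefs mu0 A (fun j l th => L l (xi l j w) th) i
                                   (rshift NS k) ts) @ \oo --> (1 : R)}
    /\
    forall th, th != ts ->
    {ae P, forall w, (fun i => ln (beliefs mu0 A (fun j l th => L l (xi l j w) th) i
                                   (rshift NS k) th) / i%:R) @ \oo -->
                     (Dagg A cS p nu f L k ts - Dagg A cS p nu f L k th)}.
Proof.
move=> k ts Hts.
(* The finitely many agents and hypotheses share one almost sure event; on it the argument is
   deterministic. *)
have good : {ae P, forall w, forall lt : 'I_(NS + NR) * 'I_H,
    (forall i, 0 < f lt.1 (xi lt.1 i w) /\ 0 < L lt.1 (xi lt.1 i w) lt.2) /\
    (\sum_(i < n) (ln (f lt.1 (xi lt.1 i w)) - ln (L lt.1 (xi lt.1 i w) lt.2))) / n%:R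
      @[n --> \oo] --> fine (KL (nu lt.1) (f lt.1) (fun x => L lt.1 x lt.2))}.
  apply: filter_forall => -[l th] /=; apply: filterI.
    by apply: (ae_likelihood_gt0 P (nu l) (f l) (fun x => L l x th) (xi l));
      auto using Hf0, Hf_meas, HL0, HL_meas, Hxi_meas, Hxi_law, Hkl.
  by apply: (slln_log_likelihood P (nu l) (f l) (fun x => L l x th) (xi l));
    auto using Hf0, Hf_meas, HL0, HL_meas, Hxi_meas, Hxi_law, Hxi_indep, Hkl.
suff H1 : {ae P, forall w,
    ((fun i => beliefs mu0 A (fun j l th => L l (xi l j w) th) i
       (rshift NS k) ts) @ \oo --> (1 : R)) /\
    forall th, th != ts ->
    (fun i => ln (beliefs mu0 A (fun j l th => L l (xi l j w) th) i
       (rshift NS k) th) / i%:R) @ \oo -->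
      (Dagg A cS p nu f L k ts - Dagg A cS p nu f L k th)}.
  split; first by apply: filterS H1 => w [].
  by move=> th tn; apply: filterS H1 => w [_]; apply.
apply: filterS good => w good.
pose lik j l th := L l (xi l j w) th.
have lik0 j l th : 0 < lik j l th by have [/(_ j)[]] := good (l, th).
apply: (posterior_concentration (fun i => beliefs mu0 A lik i (rshift NS k)) ts
  (fun th => Dagg A cS p nu f L k ts - Dagg A cS p nu f L k th)).
- by move=> i th; exact: beliefs_gt0.
- by move=> i; exact: beliefs_sum.
- by move=> th tn; rewrite subr_lt0 Hts.
move=> th tn; apply/sublinear_avg.
pose lam i := \row_l (ln (beliefs mu0 A lik i l th) - ln (beliefs mu0 A lik i l ts)).
pose x i := \row_l (ln (lik i l th) - ln (lik i l ts)).
pose kl l th' := fine (KL (nu l) (f l) (fun x => L l x th')).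
pose c := \row_l (kl l ts - kl l th).
have lamS i : lam i.+1 = (lam i + x i) *m A.
  apply/rowP => j; rewrite mxE log_ratio_beliefs// mxE.
  by apply: eq_bigr => l _; rewrite !mxE.
have sx : vsublinear (fun i => \sum_(j < i) x j - i%:R *: c).
  (* [ln (f l)] cancels between the strong laws for [ts] and [th], leaving the log-likelihood ratio
     of [th] to [ts], with mean [kl l ts - kl l th]. *)
  move=> l; have [_ /sublinear_avg s1] := good (l, ts).
  have [_ /sublinear_avg s2] := good (l, th).
  have := sublinearD _ _ s1 (sublinearZ (-1) _ s2); congr sublinear.
  apply/funext => n /=; rewrite !mxE summxE.
  rewrite [in RHS](eq_bigr (fun i : 'I_n => ln (lik i l th) - ln (lik i l ts))).
    by rewrite !sumrB /lik /kl; ring.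
  by move=> i _; rewrite mxE.
have := receiving_growth A cS cR p HA0 HAstoch HS HAblock HAdiag HSconn HSaper HpA
  Hppos Hpsum HRconn HRS lam x c lamS sx k.
congr sublinear; apply/funext => i; rewrite !mxE; congr (_ - _ * _).
rewrite /Dagg -sumrB; apply: eq_bigr => l _; rewrite !mxE /kl; ring.
Qed.
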